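(* Let $\psi:\mathbb R\to\mathbb R\cup\{\infty\}$ be a closed convex function that is nonnegative, satisfies $\psi(0)=0$, and whose effective domain is either $[0,\lambda_{\max})$ for some $\lambda_{\max}\in(0,\infty]$ or $[0,\lambda_{\max}]$ for some $\lambda_{\max}\in(0,\infty)$. Let $\mathcal X=\mathrm{dom}(\psi^* )$, let $\mathcal P$ be the one-sided sub-$\psi$ hypothesis on $\mathcal X$, let $\mathcal E$ be the set of e-variables for $\mathcal P$, and let $\Lambda=[0,\lambda_{\max}]$. Let $\mathcal Q$ be an alternative hypothesis, $U$ a utility function, $\chi$ a penalty function, and $\mathbb U$ the associated objective function on $\mathcal E$, as specified in the context. Assume that $$\int_{\mathcal X}e^{\psi^*}\,d\mathsf Q<\infty\quad\text{for all }\mathsf Q\in\mathcal Q.$$ Then there exists an e-variable of the form $h^*(x)=\int_\Lambda e^{\lambda x-\psi(\lambda)}\,\pi^*(d\lambda)$, $x\in\mathrm{dom}(\psi^* )$, with $\pi^*$ a Borel probability measure on $\Lambda$, that achieves the supremum $\sup_{h\in\mathcal E}\mathbb U(h)$.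
   Context: $\mathrm{dom}(\phi)=\{\phi<\infty\}$; closed means closed epigraph; $\psi^*(x)=\sup_{\lambda\in\mathbb R}\{\lambda x-\psi(\lambda)\}$. A probability measure $\mu$ on $\mathbb R$ is (one-sided) sub-$\psi$ if $\int e^{\lambda x}\mu(dx)\le e^{\psi(\lambda)}$ for all $\lambda\in\mathrm{dom}(\psi)$. All such measures are concentrated on $\mathrm{dom}(\psi^* )$, so $\mathcal X=\mathrm{dom}(\psi^* )$ with its Borel $\sigma$-algebra, and $\mathcal P$ is the set of sub-$\psi$ probability measures on $\mathcal X$. $\Lambda=[0,\lambda_{\max}]$ is compact, with $\lambda_{\max}=\infty$ allowed; if $\lambda_{\max}\notin\mathrm{dom}(\psi)$, $e^{\lambda x-\psi(\lambda)}$ at $\lambda=\lambda_{\max}$ is understood as $\lim_{\lambda\uparrow\lambda_{\max}}e^{\lambda x-\psi(\lambda)}$. An e-variable for $\mathcal P$ is a measurable $h:\mathcal X\to[0,\infty]$ with $\int h\,d\mu\le 1$ for all $\mu\in\mathcal P$. A measurable set is $\mathcal P$-negligible if it has measure zero under all $\mu\in\mathcal P$ (similarly for $\mathcal Q$). Alternative hypothesis: a family $\mathcal Q$ of probability measures on $\mathcal X$ such that every $\mathcal P$-negligible set is $\mathcal Q$-negligible. Utility function: a nondecreasing upper semicontinuous $U:[0,\infty)\to[-\infty,\infty)$ for which there exist $a\in\mathbb R$, $b>0$ with $U(x)\le a+bx$ for all $x\in[0,\infty)$. Penalty function: an arbitrary $\chi:\mathcal Q\to\mathbb R$. Objective: $$\mathbb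 U(h)=\inf_{\mathsf Q\in\mathcal Q}\Big\{\int_{\mathcal X}U(h)\,d\mathsf Q-\chi(\mathsf Q)\Big\},\quad h\in\mathcal E,$$ with the convention that the integral is $-\infty$ whenever $\int U(h)^-\,d\mathsf Q=\infty$. (E-variables are finite outside a $\mathcal P$-negligible, hence $\mathcal Q$-negligible, set.) *)

(* Defs.v *)
From HB Require Import structures.
From mathcomp Require Import all_boot all_order all_algebra.
From mathcomp Require Import all_classical all_reals all_analysis.
From mathcomp Require Import measurable_realfun.

Set Implicit Arguments.
Unset Strict Implicit.
Unset Printing Implicit Defensive.

Import Order.TTheory GRing.Theory Num.Theory.
Import numFieldNormedType.Exports.
Local Open Scope classical_set_scope.
Local Open Scope ring_scope.
Local Open Scope ereal_scope.

Definition dom (R : realType) (f : R -> \bar R) : set R :=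
  [set x | f x < +oo].

Definition epigraph (R : realType) (f : R -> \bar R) : set (R^o * R^o) :=
  [set p | f p.1 <= p.2%:E].

Definition conjugate (R : realType) (f : R -> \bar R) (x : R) : \bar R :=
  ereal_sup (range (fun l : R => (l * x)%:E - f l)).

(* Standing assumptions on psi. Values in R u {+oo} follow from nonnegativity.
   The endpoint lmax is extended real; the half-open case allows lmax = +oo. *)
Record admissible_psi (R : realType) (lmax : \bar R) (psi : R -> \bar R) :
    Prop := {
  psi_closed : closed (epigraph psi) ;
  psi_convex : convex_set (epigraph psi) ;
  psi_ge0 : forall l, 0 <= psi l ;
  psi_at0 : psi 0%R = 0 ;
  lmax_gt0 : 0 < lmax ;
  psi_dom : dom psi = [set l : R | 0 <= l%:E < lmax] \/
            (lmax < +oo /\ dom psi = [set l : R | 0 <= l%:E <= lmax])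
}.

(* Sample space X = dom psi^*. Objects on X are represented on R: a measure on
   X is a Borel measure on R giving mass 0 to the complement of X, and a
   function on X is a function on R of which only the values on X are used. *)
Definition sample_space (R : realType) (psi : R -> \bar R) : set R :=
  dom (conjugate psi).

Definition measure_on (R : realType) (X : set R) (mu : probability R R) :
  Prop := mu (~` X) = 0.

Definition sub_psi (R : realType) (psi : R -> \bar R) (mu : probability R R) :
  Prop :=
  forall l, dom psi l -> \int[mu]_x (expR (l * x))%:E <= expeR (psi l).

Definition null_hypothesis (R : realType) (psi : R -> \bar R) :
    set (probability R R) :=
  [set mu | measure_on (sample_space psi) mu /\ sub_psi psi mu].

Definition e_variable (R : realType) (psi : R -> \bar R) : set (R -> \bar R) :=
  [set h | [/\ measurable_fun (sample_space psi) h,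
     forall x, sample_space psi x -> 0 <= h x &
     forall mu, null_hypothesis psi mu ->
       \int[mu]_(x in sample_space psi) h x <= 1]].

Definition negligible_for (R : realType) (P : set (probability R R))
  (N : set R) : Prop := forall mu, P mu -> mu N = 0.

Definition alternative_hypothesis (R : realType) (psi : R -> \bar R)
    (Qs : set (probability R R)) : Prop :=
  (forall Q, Qs Q -> measure_on (sample_space psi) Q) /\
  (forall N, measurable N -> N `<=` sample_space psi ->
    negligible_for (null_hypothesis psi) N -> negligible_for Qs N).

Definition upper_semicontinuous_on (R : realType) (D : set R)
  (f : R -> \bar R) : Prop :=
  forall x (a : R), D x -> f x < a%:E ->
    \forall y \near within D (nbhs x), f y < a%:E.

(* Only the values of U on [0, +oo[ are constrained and used. *)
Record utility (R : realType) (U : R -> \bar R) : Prop := {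
  utility_lty : forall x : R, (0 <= x)%R -> U x < +oo ;
  utility_nd : forall x y : R, (0 <= x)%R -> (x <= y)%R -> U x <= U y ;
  utility_usc : upper_semicontinuous_on [set x : R | (0 <= x)%R] U ;
  utility_affine : exists a b : R, (0 < b)%R /\
    forall x : R, (0 <= x)%R -> U x <= (a + b * x)%:E
}.

(* U is not defined at +oo; e-variables are finite Q-almost surely, so U(h) is
   integrated over the part of X where h is finite. *)
Definition utility_integral (R : realType) (psi : R -> \bar R)
    (U : R -> \bar R) (h : R -> \bar R) (Q : probability R R) : \bar R :=
  let D := sample_space psi `&` dom h in
  let u := fun x => U (fine (h x)) in
  if \int[Q]_(x in D) (u^\- x) == +oo then -oo else \int[Q]_(x in D) u x.

Definition objective (R : realType) (psi : R -> \bar R)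
    (Qs : set (probability R R)) (U : R -> \bar R)
    (chi : probability R R -> R) (h : R -> \bar R) : \bar R :=
  ereal_inf [set utility_integral psi U h Q - (chi Q)%:E | Q in Qs].

Definition Lam (R : realType) (lmax : \bar R) : set (\bar R) :=
  [set l | 0 <= l <= lmax].

Definition exp_term (R : realType) (psi : R -> \bar R) (x l : R) : \bar R :=
  expeR ((l * x)%:E - psi l).

(* exp_term extended to [0, lmax]: on [0, lmax] the left limits below occur only
   at l = lmax not in dom psi. The value at -oo is never used. *)
Definition ext_exp_term (R : realType) (psi : R -> \bar R) (x : R)
    (l : \bar R) : \bar R :=
  match l with
  | r%:E => if psi r < +oo then exp_term psi x r
            else lim (exp_term psi x t @[t --> r^'-])
  | +oo => lim (exp_term psi x t @[t --> +oo%R])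
  | -oo => 0
  end.

(* Borel probability measures on [0, lmax] are represented as Borel probability
   measures on \bar R giving mass 0 to its complement. *)
Definition mixture (R : realType) (lmax : \bar R) (psi : R -> \bar R)
    (pi : probability (\bar R) R) (x : R) : \bar R :=
  \int[pi]_(l in Lam lmax) ext_exp_term psi x l.

(* Main.v *)
(* The set of sub-psi laws is dual to the curve l |-> e^(l x - psi l): if the
   weights w_i >= 0 at points x_i satisfy sum w_i e^(l x_i - psi l) <= s for all
   l, then sum w_i h(x_i) <= s for every e-variable h, because w / s, completed
   by an atom far to the left, is almost a sub-psi law. A Blackwell-type greedy
   argument turns this into finite uniform averages of the exponentials that
   approximately dominate h at finitely many points.
   Mixing measures are encoded by their nondecreasing quantile functions, so
   compactness is Helly's selection theorem, and mixtures converge by dominated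
   convergence with bound e^(psi^* x). Hence every e-variable is dominated by a
   mixture, and along a maximising sequence of e-variables the dominating
   mixtures have a limit mixture. Since U (h) <= a + b e^(psi^* ), which is
   Q-integrable, the reverse Fatou lemma and upper semicontinuity of U show that
   the limit attains the supremum. *)
Require Import Defs.
From HB Require Import structures.
From mathcomp Require Import all_boot all_order all_algebra.
From mathcomp Require Import all_classical all_reals all_analysis.
From mathcomp Require Import measurable_realfun.
From mathcomp Require Import lra ring.

Set Implicit Arguments.
Unset Strict Implicit.
Unset Printing Implicit Defensive.

Import Order.TTheory GRing.Theory Num.Theory.
Import numFieldNormedType.Exports.
Local Open Scope classical_set_scope.
Local Open Scope ring_scope.

(** * Averages of exponentials and monotone selection *)

(* Greedy choice against the positive part w of the accumulated deficit
   D s = sum_(t in s) (h - a t): its squared norm grows only linearly in the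
   number of steps, so the average deficit tends to 0. *)
Lemma uniform_average_dominates (R : realType) (n : nat) (T : Type)
    (a : T -> 'I_n -> R) (h : 'I_n -> R) (C : R) :
  (forall t i, `|a t i| <= C) ->
  (forall w : 'I_n -> R, (forall i, 0 <= w i) ->
    exists t, \sum_i w i * h i <= \sum_i w i * a t i + 1) ->
  forall e : R, 0 < e -> exists s : seq T, (0 < size s)%N /\
    forall i, h i - e <= (size s)%:R^-1 * \sum_(t <- s) a t i.
Proof.
move=> aC sep e e0.
(* One step raises the squared norm by at most [K]: the sum bounds the squared increment, and 2 is
   the slack 1 of the hypothesis doubled by the cross term. *)
pose K : R := \sum_i (`|h i| + C) ^+ 2 + 2.
pose D s i := \sum_(t <- s) (h i - a t i).
have step (m : nat) : exists s : seq T, size s = m /\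
    \sum_i (Num.max 0 (D s i)) ^+ 2 <= m%:R * K.
  elim: m => [|N [s [sN IH]]].
    exists [::]; split => //; rewrite mul0r big1// => i _.
    by rewrite /D big_nil maxxx expr0n.
  have w0 i : 0 <= Num.max 0 (D s i) by rewrite le_max lexx.
  have [t ht] := sep _ w0.
  exists (t :: s); split; first by rewrite /= sN.
  have le1 i : (Num.max 0 (D (t :: s) i)) ^+ 2 <=
      (Num.max 0 (D s i)) ^+ 2 + 2 * (Num.max 0 (D s i) * (h i - a t i)) +
      (`|h i| + C) ^+ 2.
    rewrite {1}/D big_cons -/(D s i).
    set d := h i - a t i; set S := D s i; set W := Num.max 0 S.
    have dK : d ^+ 2 <= (`|h i| + C) ^+ 2.
      rewrite -(@real_normK _ d) ?num_real// lerXn2r ?nnegrE ?addr_ge0//.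
        exact: le_trans (normr_ge0 _) (aC t i).
      by rewrite (le_trans (ler_normB _ _))// lerD2l.
    have SW : S <= W by rewrite le_max lexx orbT.
    have W0 : 0 <= W by rewrite le_max lexx.
    have : Num.max 0 (d + S) ^+ 2 <= (W + d) ^+ 2.
      by case: (leP 0 (d + S)) => dS; [nra | rewrite expr0n sqr_ge0].
    by move: dK; nra.
  apply: le_trans (ler_sum _ (fun i _ => le1 i)) _.
  rewrite !big_split/= -mulr_sumr.
  have -> : \sum_(i < n) Num.max 0 (D s i) * (h i - a t i) =
     \sum_i Num.max 0 (D s i) * h i - \sum_i Num.max 0 (D s i) * a t i.
    by rewrite -sumrB; apply: eq_bigr => i _; rewrite mulrBr.
  rewrite -natr1 mulrDl mul1r.
  have KE : K = \sum_i (`|h i| + C) ^+ 2 + 2 by [].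
  by move: ht IH KE; lra.
have K0 : 0 < K by rewrite ltr_wpDl// sumr_ge0// => i _; rewrite sqr_ge0.
(* After [M] steps a positive deficit has square at most [M K <= (M e)^2], so its average is at most
   [e]. *)
pose M := (Num.truncn (K / e ^+ 2)).+1.
have NK : K <= M%:R * e ^+ 2.
  by rewrite -ler_pdivrMr ?exprn_gt0// ltW// truncnS_gt.
have [s [sN hs]] := step M; exists s; rewrite sN; split => // i.
have N0 : 0 < M%:R :> R by rewrite ltr0n.
have hi : (Num.max 0 (D s i)) ^+ 2 <= M%:R * K.
  apply: le_trans hs; rewrite (bigD1 i)//= lerDl sumr_ge0// => j _.
  by rewrite sqr_ge0.
have DNe : D s i <= M%:R * e.
  rewrite leNgt; apply/negP => eD.
  have Ne0 : 0 < M%:R * e by rewrite mulr_gt0.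
  move: hi; rewrite max_r; last by rewrite ltW// (lt_trans _ eD).
  apply/negP; rewrite -ltNge.
  have : (M%:R * e) ^+ 2 < D s i ^+ 2.
    by rewrite ltrXn2r// ?nnegrE ltW// (lt_trans _ eD).
  by apply: le_lt_trans; rewrite exprMn expr2 -mulrA ler_pM2l.
move: DNe; rewrite /D big_split/= sumrN big_const_seq count_predT sN
  iter_addr_0.
rewrite -[h i *+ M]mulr_natl ler_pdivlMl// mulrBr.
by move: (_ * h i) (_ * e) => x y; lra.
Qed.

Local Open Scope ereal_scope.

(** Real levels below and above the limit are tested separately, which treats finite and infinite
    limits alike and fits one-sided semicontinuity arguments. *)
Lemma cvge_order (R : realType) (T : Type) (F : set_system T) {FF : Filter F}
    (f : T -> \bar R) (l : \bar R) :
  (forall c : R, c%:E < l -> \forall t \near F, c%:E < f t) ->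
  (forall c : R, l < c%:E -> \forall t \near F, f t < c%:E) ->
  f @ F --> l.
Proof.
case: l => [l| |] lo up; last 2 first.
- by apply/cvgeyPgt => A; apply: lo; rewrite ltry.
- by apply/cvgeNyPlt => A; apply: up; rewrite ltNyr.
apply/fine_cvgP; split.
  have := lo (l - 1)%R; have := up (l + 1)%R.
  rewrite !lte_fin ltrDl ltrBlDr ltrDl => /(_ ltr01) h1 /(_ ltr01) h2.
  near=> t.
  rewrite fin_real//; apply/andP; split.
    by apply: (@lt_trans _ _ (l - 1)%:E); [rewrite ltNyr|near: t].
  by apply: (@lt_trans _ _ (l + 1)%:E); [near: t|rewrite ltry].
apply/cvgrPdist_lt => e e0.
have := lo (l - e)%R; have := up (l + e)%R.
rewrite !lte_fin ltrDl ltrBlDr ltrDl => /(_ e0) h1 /(_ e0) h2.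
near=> t.
have : (l - e)%:E < f t by near: t.
have : f t < (l + e)%:E by near: t.
rewrite /=; case: (f t) => [r| |]//=; rewrite !lte_fin => A B.
by rewrite ltr_norml; lra.
Unshelve. all: end_near. Qed.

Lemma ereal_lt_rat (R : realType) (x y : \bar R) :
  x < y -> exists c : rat, x < (ratr c)%:E < y.
Proof.
move: x y => [x| |] [y| |]//.
- by rewrite lte_fin => /rat_in_itvoo[c]; rewrite in_itv/= => ?; exists c.
- move=> _; have /rat_in_itvoo[c] : (x < x + 1)%R by rewrite ltrDl.
  by rewrite in_itv/= => /andP[? _]; exists c; rewrite lte_fin ltry andbT.
- move=> _; have /rat_in_itvoo[c] : (y - 1 < y)%R by rewrite ltrBlDr ltrDl.
  by rewrite in_itv/= => /andP[_ ?]; exists c; rewrite lte_fin ltNyr.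
- by move=> _; exists 0%R; rewrite ltNyr ltry.
Qed.

(* An ultrafilter on nat decides every proposition "c <= q n r" with rational
   c, r; a diagonal subsequence agrees with it on any finite set of them. *)
Lemma helly_selection (R : realType) (q : nat -> R -> \bar R) (b : \bar R) :
  0 <= b -> (forall n, {homo q n : x y / (x <= y)%R >-> x <= y}) ->
  (forall n t, 0 <= q n t <= b) ->
  exists (phi : nat -> nat) (g : R -> \bar R),
    [/\ forall k, (k <= phi k)%N, {homo g : x y / (x <= y)%R >-> x <= y},
      forall t, 0 <= g t <= b &
      countable [set t | ~ (q (phi k) t @[k --> \oo] --> g t)]].
Proof.
move=> b0 qm qb.
have [G [GU oG]] := ultraFilterLemma (eventually_filter).
pose B (p : rat * rat) := [set n | (ratr p.1)%:E <= q n (ratr p.2)].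
(* The tests [B p] listed by code; a number coding no pair gets the trivial test. *)
pose Bj (j : nat) : set nat := if unpickle j is Some p then B p else setT.
have Gphi k : exists n, (k <= n)%N /\
    forall j, (j < k)%N -> (Bj j n <-> G (Bj j)).
  have : G [set n | (k <= n)%N /\
      forall j, (j < k)%N -> (Bj j n <-> G (Bj j))].
    have dec j : G [set n | Bj j n <-> G (Bj j)].
      have [GB|GB] := in_ultra_setVsetC (Bj j) GU.
        by apply: (filterS _ GB) => n Bn; split.
      apply: (filterS _ GB) => n Bn; split => // GBj.
      by have /filter_ex[m []] : G (~` Bj j `&` Bj j) by exact: filterI.
    have kG : G [set n | (k <= n)%N] by apply: oG; exact: nbhs_infty_ge.
    suff decs : G [set n | forall j, (j < k)%N -> (Bj j n <-> G (Bj j))].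
      by apply: filterS2 kG decs => n; split.
    elim: {kG} k => [|k IH]; first by apply: (filterS _ filterT) => n _ j.
    apply: filterS2 IH (dec k) => n h1 h2 j.
    by rewrite ltnS leq_eqVlt => /orP[/eqP ->|/h1].
  by move=> /filter_ex[n hn]; exists n.
have [phi phiP] := choice Gphi.
have phik k : (k <= phi k)%N by have [] := phiP k.
have phiB p : \forall k \near \oo, B p (phi k) <-> G (B p).
  exists (pickle p).+1 => //= k pk.
  by have [_ /(_ (pickle p) pk)] := phiP k; rewrite /Bj pickleK.
(* The limit [g t] is the supremum of the levels reached, along the ultrafilter, at some rational
   left of [t]; the level 0 ensures [0 <= g t]. *)
pose S (t : R) : set (\bar R) := [set (ratr c)%:E | c in
  [set c : rat | (c = 0%R) \/ exists2 r : rat, (ratr r < t)%R & G (B (c, r))]].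
pose g t := ereal_sup (S t).
have gm : {homo g : x y / (x <= y)%R >-> x <= y}.
  move=> x y xy; apply: le_ereal_sup => _ [c hc <-]; exists c => //.
  case: hc => [|[r rx Gr]]; [by left|right; exists r => //].
  exact: lt_le_trans xy.
have gb t : 0 <= g t <= b.
  apply/andP; split.
    by apply: ereal_sup_ubound; exists 0%R; [left|rewrite rmorph0].
  apply: ge_ereal_sup => _ [c hc <-]; case: hc => [->|[r rt Gr]].
    by rewrite rmorph0.
  have /filter_ex[n] := Gr; rewrite /B/= => /le_trans; apply.
  by have /andP[] := qb n (ratr r).
(* Points where [g] jumps across [c]: at most one for each [c] by monotonicity. Convergence holds
   everywhere else. *)
pose bad (c : rat) := [set t | g t < (ratr c)%:E /\
   forall t', (t < t')%R -> (ratr c)%:E <= g t'].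
exists phi, g; split => //.
suff sub : [set t | ~ (q (phi k) t @[k --> \oo] --> g t)] `<=`
    \bigcup_(c in [set: rat]) bad c.
  apply: sub_countable (subset_card_le sub) _.
  apply: bigcup_countable => // c _.
  have [[t ht]|] := pselect (exists t, bad c t).
    apply: (@sub_countable _ _ _ [set t]) (countable1 t); apply: subset_card_le.
    move=> u [u1 u2]; case: ht => t1 t2 /=.
    by have [ut|tu|] := ltgtP u t => //;
      [have := u2 _ ut|have := t2 _ tu]; rewrite leNgt ?t1 ?u1.
  move=> nobad; rewrite (_ : bad c = set0)//.
  by apply/seteqP; split => // t bt; apply: nobad; exists t.
move=> t /= ncv; apply: contrapT => nb; apply: ncv.
have nbad c : ~ bad c t by move=> bc; apply: nb; exists c.
apply: cvge_order => c hc.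
- have : exists2 y, S t y & c%:E < y by apply/ereal_sup_gtP.
  move=> [_ [d hd <-]] cd; case: hd => [d0|[r rt Gr]].
    apply: nearW => k; apply: lt_le_trans cd _; rewrite d0 rmorph0.
    by have /andP[] := qb (phi k) t.
  have := phiB (d, r); apply: filterS => k [_ /(_ Gr)] => Bk.
  exact: lt_le_trans cd (le_trans Bk (qm _ _ _ (ltW rt))).
- have [d /andP[gd dc]] := ereal_lt_rat hc.
  (* As [g] does not jump across [d] at [t], it is still below [d] at some [t' > t]; hence the test
     [(d, r)] fails along the ultrafilter for rational [r] in between. *)
  have : ~ forall t', (t < t')%R -> (ratr d)%:E <= g t'.
    by move=> h; apply: (nbad d).
  move=> /existsNP[t' /not_implyP[tt' /negP]]; rewrite -ltNge => gd'.
  have [r] := rat_in_itvoo tt'; rewrite in_itv/= => /andP[tr rt'].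
  have := phiB (d, r); apply: filterS => k [Bk _].
  apply: le_lt_trans dc; apply: le_trans (qm _ _ _ (ltW tr)) _.
  rewrite leNgt; apply/negP => /ltW/Bk GB.
  move: gd'; rewrite ltNge => /negP; apply.
  by apply: ereal_sup_ubound; exists d => //; right; exists r.
Qed.

(** * Continuity of the extended exponential term *)

Section exp_term.
Context (R : realType) (lmax : \bar R) (psi : R -> \bar R).
Hypothesis adm : admissible_psi lmax psi.

Lemma psi_conv_le (l m u v t : R) : (0 <= t <= 1)%R ->
  psi l <= u%:E -> psi m <= v%:E ->
  psi (t * l + (1 - t) * m)%R <= (t * u + (1 - t) * v)%:E.
Proof.
move=> /andP[t0 t1] lu mv.
have := @psi_convex _ _ _ adm _ _ (Itv01 t0 t1)
  (mem_set (lu : epigraph psi (l, u))) (mem_set (mv : epigraph psi (m, v))).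
by rewrite inE.
Qed.

(** The complement of the epigraph is open, and so is its slice at height [a]. *)
Lemma psi_lsc (l : R) (a : R) : a%:E < psi l ->
  \forall y \near l, a%:E < psi y.
Proof.
move=> al.
have : \forall y \near ((l, a) : R^o * R^o), (~` epigraph psi) y.
  apply: open_nbhs_nbhs; split; first by apply: closed_openC;
    exact: psi_closed adm.
  by rewrite /epigraph /= => /(lt_le_trans al); rewrite ltxx.
have cf : (y, a) @[y --> l] --> ((l, a) : R^o * R^o).
  by apply: (@cvg_pair _ _ _ (nbhs l) (nbhs l) (nbhs a));
    [exact: cvg_id|exact: cvg_cst].
move=> /cf /= h; near=> y.
have : (~` epigraph psi) (y, a) by near: y; exact: h.
by rewrite /epigraph /= => /negP; rewrite -ltNge.
Unshelve. all: end_near. Qed.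

Lemma psi_lt_pinfty (l : R) : (0 <= l)%R -> l%:E < lmax -> psi l < +oo.
Proof.
move=> l0 ll; suff : dom psi l by [].
by have [->|[_ ->]] := psi_dom adm => /=; rewrite lee_fin l0 ?ll ?ltW.
Qed.

Lemma dom_psi_Lam (l : R) : dom psi l -> (0 <= l)%R /\ l%:E <= lmax.
Proof.
have [->|[_ ->]] := psi_dom adm => /= /andP[]; rewrite lee_fin => -> //.
by move=> /ltW.
Qed.

(** Nearby points lie on a segment from [r] to a fixed point of the domain, 0 on the left and some
    [z > r] on the right, and the chord bounds [psi] there. At an endpoint one side is vacuous. *)
Lemma psi_usc (r a : R) : (0 <= r)%R -> r%:E <= lmax -> psi r < a%:E ->
  \forall y \near r, (0 <= y)%R -> y%:E <= lmax -> psi y < a%:E.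
Proof.
move=> r0 rl ra.
have seg z : psi z < +oo -> exists2 d : R, (0 < d)%R &
    forall t : R, (0 <= t < d)%R -> psi (t * z + (1 - t) * r)%R < a%:E.
  have := psi_ge0 adm z; have := psi_ge0 adm r.
  move: ra; case Er : (psi r) => [p| |]//; case Ez : (psi z) => [w| |]//.
  rewrite !lte_fin !lee_fin => pa p0 w0 _.
  have w1 : (0 < w + 1)%R by rewrite ltr_wpDl.
  (* Below this threshold the chord is at most [p + t w < a]; [w + 1] is used because [w] may be
     0. *)
  exists (Num.min 1 ((a - p) / (w + 1)))%R.
    by rewrite lt_min ltr01 divr_gt0 ?subr_gt0.
  move=> t /andP[t0]; rewrite lt_min => /andP[t1].
  rewrite ltr_pdivlMr// => ht.
  apply: (@le_lt_trans _ _ (t * w + (1 - t) * p)%:E).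
    by apply: psi_conv_le; rewrite ?Er ?Ez// t0 ltW.
  by rewrite lte_fin; nra.
have right : \forall y \near r, (r < y)%R -> y%:E <= lmax -> psi y < a%:E.
  have [rl'|] := ltP r%:E lmax; last first.
    move=> lr; near=> y => ry yl; exfalso.
    by have := le_trans yl lr; rewrite lee_fin leNgt ry.
  have [z rz zf] : exists2 z, (r < z)%R & psi z < +oo.
    move: rl'; case El : lmax => [m| |]//; last first.
      move=> _; exists (r + 1)%R; first by rewrite ltrDl.
      by apply: psi_lt_pinfty; rewrite ?El ?ltry// ltW// ltr_wpDl.
    rewrite lte_fin => rm; exists ((r + m) / 2)%R; first by lra.
    by apply: psi_lt_pinfty; rewrite ?El ?lte_fin; lra.
  have [d d0 hd] := seg z zf.
  have zr : (0 < z - r)%R by rewrite subr_gt0.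
  near=> y => ry _.
  have -> : y = ((y - r) / (z - r) * z + (1 - (y - r) / (z - r)) * r)%R.
    by field; rewrite gt_eqF.
  apply: hd; rewrite divr_ge0 ?subr_ge0 ?ltW//=.
  rewrite ltr_pdivrMr// ltrBlDr; near: y.
  by apply: lt_nbhsl; rewrite ltrDr mulr_gt0.
have left : \forall y \near r, (0 <= y)%R -> (y < r)%R -> psi y < a%:E.
  have [r0'|] := ltP 0%R r; last first.
    move=> lr; near=> y => y0 yr; exfalso.
    by have := lt_le_trans yr lr; rewrite ltNge y0.
  have p0 : psi 0%R < +oo by rewrite (psi_at0 adm).
  have [d d0 hd] := seg 0%R p0.
  near=> y => y0 yr.
  have -> : y = ((r - y) / r * 0 + (1 - (r - y) / r) * r)%R.
    by field; rewrite gt_eqF.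
  apply: hd; rewrite divr_ge0 ?subr_ge0 ?ltW//=.
  rewrite ltr_pdivrMr// ltrBlDr addrC -ltrBlDr; near: y.
  by apply: lt_nbhsr; rewrite ltrBlDr ltrDl mulr_gt0.
near=> y => y0 yl.
have [yr|ry|->//] := ltgtP y r.
- by move: y0 yr; near: y.
- by move: ry yl; near: y.
Unshelve. all: end_near. Qed.

Lemma exp_termE (x l : R) : psi l < +oo ->
  exp_term psi x l = (expR (l * x - fine (psi l)))%:E.
Proof.
by have := psi_ge0 adm l; rewrite /exp_term; case: (psi l).
Qed.

Lemma exp_term_pinfty (x l : R) : psi l = +oo -> exp_term psi x l = 0.
Proof. by rewrite /exp_term => ->. Qed.

(** If [psi r] is finite, the two semicontinuities give convergence of [psi] along [f]. If it is
    infinite, lower semicontinuity sends [psi (f t)] to infinity and the exponential to 0. *)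
Lemma exp_term_cvg (T : Type) (F : set_system T) {FF : Filter F} (f : T -> R)
    (x r : R) : f @ F --> r ->
  (\forall t \near F, (0 <= f t)%R /\ (f t)%:E <= lmax) ->
  (0 <= r)%R -> r%:E <= lmax ->
  exp_term psi x (f t) @[t --> F] --> exp_term psi x r.
Proof.
move=> fr fL r0 rl.
have [pf|] := ltP (psi r) +oo; last first.
  rewrite leye_eq => /eqP Er; rewrite (exp_term_pinfty x Er).
  apply: cvge_order => c; first by move=> c0; apply: nearW => t;
    exact: lt_le_trans (expeR_ge0 _).
  rewrite lte_fin => c0.
  have h1 : \forall t \near F, (f t * x < r * x + 1)%R.
    have : (f t * x)%R @[t --> F] --> (r * x)%R by apply: cvgMr_tmp.
    by move=> /cvgr_lt; apply; rewrite ltrDl.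
  (* Combined with the previous bound, this level puts the exponent below [ln c]. *)
  have h2 : \forall t \near F, (r * x + 1 - ln c)%:E < psi (f t).
    have h : (r * x + 1 - ln c)%:E < psi r by rewrite Er ltry.
    exact: (fr _ (psi_lsc h)).
  near=> t.
  have h1t : (f t * x < r * x + 1)%R by near: t.
  have h2t : (r * x + 1 - ln c)%:E < psi (f t) by near: t.
  rewrite /exp_term; move: h2t; case: (psi (f t)) => [p h2t|_|//] /=;
    last by rewrite lte_fin.
  by rewrite lte_fin -[ltRHS](lnK c0) ltr_expR; move: h2t; rewrite lte_fin; lra.
have pcv : psi (f t) @[t --> F] --> psi r.
  apply: cvge_order => c hc; first exact: (fr _ (psi_lsc hc)).
  by apply: filterS2 fL (fr _ (psi_usc r0 rl hc)) => t [a b] /(_ a b).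
have Er : psi r = (fine (psi r))%:E by rewrite fineK// ge0_fin_numE// (psi_ge0
  adm).
move: pcv; rewrite {1}Er => /fine_cvgP[pfin pcv].
rewrite (exp_termE _ pf).
apply/fine_cvgP; split.
  by apply: filterS pfin => t ht; rewrite exp_termE// ltey_eq ht.
have : (f t * x - fine (psi (f t)))%R @[t --> F] --> (r * x - fine (psi r))%R.
  by apply: cvgB => //; apply: cvgMr_tmp.
move=> /(continuous_cvg _ (@continuous_expR _ _)).
apply: cvg_trans; apply: near_eq_cvg; apply: filterS pfin => t ht /=.
by rewrite exp_termE// ltey_eq ht.
Unshelve. all: end_near. Qed.

(** The exponent [l x - psi l] is concave in [l], so between two points it is at least the smaller
    end value. For [c >= 0] both end values of [psi] are finite. *)
Lemma exp_term_quasiconcave (x a s t : R) (c : \bar R) : (a <= s <= t)%R ->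
  c < exp_term psi x a -> c < exp_term psi x t -> c < exp_term psi x s.
Proof.
move=> /andP[as_ st] ca ct.
have [c0|c0] := ltP c 0; first exact: lt_le_trans c0 (expeR_ge0 _).
move: ca ct; rewrite /exp_term.
have := psi_ge0 adm a; have := psi_ge0 adm t.
case Ea : (psi a) => [p| |]//=; last by rewrite [c < 0]ltNge c0.
case Et : (psi t) => [w| |]//=; last by rewrite [c < 0]ltNge c0.
move=> w0 p0 ca ct.
have [at_|ta] := ltP a t; last first.
  have -> : s = a by apply/eqP; rewrite eq_le as_ (le_trans st ta).
  by rewrite Ea.
pose th := ((t - s) / (t - a))%R.
have ta0 : (0 < t - a)%R by rewrite subr_gt0.
have th01 : (0 <= th <= 1)%R.
  by rewrite divr_ge0 ?subr_ge0//= ?(ltW at_)// ler_pdivrMr// mul1r lerD2l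
    lerN2.
have sE : s = (th * a + (1 - th) * t)%R by rewrite /th; field; rewrite gt_eqF.
have := @psi_conv_le a t p w th th01; rewrite Ea Et !lexx -sE => /(_ isT isT).
have := psi_ge0 adm s.
case Es : (psi s) => [v| |]//=; rewrite lee_fin => v0; rewrite lee_fin => vle.
have key : (Num.min (a * x - p) (t * x - w) <= s * x - v)%R.
  rewrite ge_min; apply/orP.
  have sx : (s * x = th * (a * x) + (1 - th) * (t * x))%R.
    by rewrite {1}sE; ring.
  have [h|h] := leP (a * x - p)%R (t * x - w)%R; [left|right];
    rewrite sx; move: th01 vle h {sx sE} => /andP[];
    by move: th (a * x)%R (t * x)%R => th ax tx; nra.
case: (leP (a * x - p)%R (t * x - w)%R) key => _ key.
  by apply: lt_le_trans ca _; rewrite lee_fin ler_expR.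
by apply: lt_le_trans ct _; rewrite lee_fin ler_expR.
Qed.

(* For c below the limit superior L, f takes values above c arbitrarily far
   out, hence on a whole half-line by quasiconcavity. *)
Lemma exp_term_cvg_pinfty (x : R) : lmax = +oo ->
  cvg (exp_term psi x t @[t --> +oo%R]).
Proof.
move=> ly; set f := exp_term psi x.
pose L := ereal_inf [set ereal_sup [set f t | t in [set t | (b <= t)%R]] | b in
  [set b : R | True]].
apply/cvg_ex; exists L; apply: cvge_order => c hc.
- have ex b : exists2 t, (b <= t)%R & c%:E < f t.
    have : c%:E < ereal_sup [set f t | t in [set t | (b <= t)%R]].
      by apply: lt_le_trans hc _; apply: ereal_inf_lbound; exists b.
    by move=> /ereal_sup_gtP[_ [t bt <-] ct]; exists t.
  have [a _ ca] := ex 0%R.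
  near=> s.
  have [t st ct] := ex s.
  apply: exp_term_quasiconcave ca ct; rewrite st andbT.
  by near: s; apply: nbhs_pinfty_ge; rewrite num_real.
- move: hc => /ereal_inf_ltP[_ [b _ <-] hb].
  near=> t; apply: le_lt_trans hb; apply: ereal_sup_ubound; exists t => //=.
Unshelve. all: end_near. Qed.

End exp_term.

Lemma expR_convex (R : realType) (a b t : R) : (0 <= t <= 1)%R ->
  (expR (a + t * (b - a)) <= (1 - t) * expR a + t * expR b)%R.
Proof.
move=> /andP[t0 t1].
have := convex_expR (Itv01 t0 t1) b a.
rewrite !convRE /= /unstable.onem => h.
by rewrite [leRHS]addrC; apply: le_trans h; rewrite ler_expR; lra.
Qed.

Lemma nondecreasing_emeasurable (R : realType) (f : R -> \bar R) :
  {homo f : x y / (x <= y)%R >-> x <= y} -> measurable_fun setT f.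
Proof.
move=> fm; apply: (measurability _ (ErealGenCInfty.measurableE R)).
move=> /= _ [_ [a ->]] <-; rewrite setTI.
apply: is_interval_measurable => x y /=.
rewrite /preimage/= !in_itv/= !andbT => fx _ z /andP[xz _].
by rewrite in_itv/= andbT (le_trans fx)// fm.
Qed.

Section ext_exp_term.
Context (R : realType) (lmax : \bar R) (psi : R -> \bar R).
Hypothesis adm : admissible_psi lmax psi.

(** At a finite endpoint outside the domain both sides are 0, by continuity from the left; thus +oo
    is the only point where the extension is a genuine limit. *)
Lemma ext_exp_term_fin (x r : R) : (0 <= r)%R -> r%:E <= lmax ->
  ext_exp_term psi x r%:E = exp_term psi x r.
Proof.
move=> r0 rl; rewrite /ext_exp_term; case: ifPn => //.
rewrite -leNgt leye_eq => /eqP Er.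
have {}r0 : (0 < r)%R.
  rewrite lt_neqAle r0 andbT; apply/eqP => r00.
  by move: Er; rewrite -r00 (psi_at0 adm).
apply/cvg_lim => //; apply: (exp_term_cvg adm) => //.
- exact: (@cvg_at_left_filter R R id r r cvg_id).
- near=> t; split; first by near: t; exact: nbhs_left_ge.
  by apply: le_trans rl; rewrite lee_fin; near: t; exact: nbhs_left_le.
- exact: ltW.
Unshelve. all: end_near. Qed.

Lemma ext_exp_term_pinfty (x : R) : lmax = +oo ->
  exp_term psi x t @[t --> +oo%R] --> ext_exp_term psi x +oo.
Proof. by move=> ly; exact: (exp_term_cvg_pinfty adm). Qed.

Variant Lam_spec : \bar R -> Type :=
| LamFin r of (0 <= r)%R & r%:E <= lmax : Lam_spec r%:E
| LamPinfty of lmax = +oo : Lam_spec +oo.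

Lemma LamP l : Lam lmax l -> Lam_spec l.
Proof.
rewrite /Lam/=; case: l => [r /andP[r0 rl]|/andP[_ yl]|/andP[]//].
- by constructor.
- by constructor; apply/eqP; rewrite -leye_eq.
Qed.

Lemma ext_exp_term_cvg (x : R) (u : nat -> \bar R) (l : \bar R) :
  (forall k, Lam lmax (u k)) -> Lam lmax l -> u k @[k --> \oo] --> l ->
  ext_exp_term psi x (u k) @[k --> \oo] --> ext_exp_term psi x l.
Proof.
move=> uL /LamP[r r0 rl|ly].
  move=> /fine_cvgP[ufin ucv]; rewrite ext_exp_term_fin//.
  have fL : \forall k \near \oo, (0 <= fine (u k))%R /\ (fine (u k))%:E <= lmax.
    by apply: filterS ufin => k; case: (LamP (uL k)).
  have h : exp_term psi x (fine (u k)) @[k --> \oo] --> exp_term psi x r.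
    exact: (exp_term_cvg adm).
  apply: cvg_trans h; apply: near_eq_cvg; apply: filterS ufin => k /=.
  by case: (LamP (uL k)) => [s s0 sl _|//]; rewrite ext_exp_term_fin.
move=> /cvgeyPgt ucv.
(* The sequence may mix real terms with terms equal to +oo, so a neighbourhood must be checked at
   +oo and at all large reals. *)
have ev (P : set (\bar R)) : P (ext_exp_term psi x +oo) ->
    (\forall t \near +oo%R, P (exp_term psi x t)) ->
    \forall k \near \oo, P (ext_exp_term psi x (u k)).
  move=> Py [A [_ AP]]; apply: filterS (ucv A) => k.
  case: (LamP (uL k)) => [s s0 sl|//]; rewrite lte_fin ext_exp_term_fin// => As.
  exact: AP.
move=> P Pl; apply: ev; first exact: nbhs_singleton Pl.
exact: (ext_exp_term_pinfty ly Pl).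
Qed.

Lemma ext_exp_term_ge0 (x : R) (l : \bar R) : Lam lmax l ->
  0 <= ext_exp_term psi x l.
Proof.
move=> /LamP[r r0 rl|ly]; first by rewrite ext_exp_term_fin// expeR_ge0.
apply: lime_ge; first exact: (exp_term_cvg_pinfty adm).
by apply: nearW => t; exact: expeR_ge0.
Qed.

Lemma exp_term_le_conjugate (x l : R) :
  exp_term psi x l <= expeR (conjugate psi x).
Proof. by rewrite lee_expeR; apply: ereal_sup_ubound; exists l. Qed.

Lemma ext_exp_term_le_conjugate (x : R) (l : \bar R) : Lam lmax l ->
  ext_exp_term psi x l <= expeR (conjugate psi x).
Proof.
move=> /LamP[r r0 rl|ly].
  by rewrite ext_exp_term_fin//; exact: exp_term_le_conjugate.
apply: lime_le; first exact: (exp_term_cvg_pinfty adm).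
by apply: nearW => t; exact: exp_term_le_conjugate.
Qed.

Lemma exp_term_nondecreasing (x y l : R) : (0 <= l)%R -> (x <= y)%R ->
  exp_term psi x l <= exp_term psi y l.
Proof.
by move=> l0 xy; rewrite lee_expeR leeB// lee_fin ler_wpM2l.
Qed.

Lemma ext_exp_term_nondecreasing (x y : R) (l : \bar R) : Lam lmax l ->
  (x <= y)%R -> ext_exp_term psi x l <= ext_exp_term psi y l.
Proof.
move=> /LamP[r r0 rl|ly] xy.
  by rewrite !ext_exp_term_fin//; exact: exp_term_nondecreasing.
apply: lee_lim; [exact: (exp_term_cvg_pinfty adm)..|].
near=> t; apply: exp_term_nondecreasing => //.
Unshelve. all: end_near. Qed.

Lemma exp_term_secant (x z t l : R) : (0 <= t <= 1)%R ->
  exp_term psi (x + t * (z - x))%R l <=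
    exp_term psi x l + t%:E * exp_term psi z l.
Proof.
move=> t01; have /andP[t0 t1] := t01; have := psi_ge0 adm l; rewrite /exp_term.
case: (psi l) => [p| |]//= _; last by rewrite mule0 adde0.
rewrite -EFinM -EFinD lee_fin.
have -> : (l * (x + t * (z - x)) - p = (l * x - p) + t * ((l * z - p) - (l * x
  - p)))%R.
  by ring.
apply: le_trans (expR_convex _ _ t01) _; rewrite lerD2r ler_piMl ?expR_ge0//.
by lra.
Qed.

(* Convexity in x, with the factor 1 - t of the first term dropped. *)
Lemma ext_exp_term_secant (x z t : R) (l : \bar R) : (0 <= t <= 1)%R ->
  Lam lmax l -> ext_exp_term psi (x + t * (z - x))%R l <=
    ext_exp_term psi x l + t%:E * ext_exp_term psi z l.
Proof.
move=> t01; have /andP[t0 t1] := t01.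
move=> /LamP[r r0 rl|ly].
  by rewrite !ext_exp_term_fin//; exact: exp_term_secant.
have cz : (fun s => t%:E * exp_term psi z s) s @[s --> +oo%R] -->
    t%:E * ext_exp_term psi z +oo.
  by apply: cvgeZl => //; exact: ext_exp_term_pinfty.
have Ly : Lam lmax +oo by rewrite /Lam/= ly leey.
have cxz : (fun s => exp_term psi x s + t%:E * exp_term psi z s) s
    @[s --> +oo%R] -->
    ext_exp_term psi x +oo + t%:E * ext_exp_term psi z +oo.
  apply: cvgeD => //; last exact: ext_exp_term_pinfty.
  by apply: ge0_adde_def; rewrite inE ?mule_ge0// ?lee_fin//;
    exact: ext_exp_term_ge0.
rewrite -(cvg_lim _ cxz)//.
apply: lee_lim; first exact: (exp_term_cvg_pinfty adm).
  by apply/cvg_ex; eexists; exact: cxz.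
by apply: nearW => s; exact: exp_term_secant.
Qed.

Lemma psi_measurable : measurable_fun setT psi.
Proof.
apply: lower_semicontinuous_measurable => x a ax.
by exists [set y | a%:E < psi y] => //; exact: (psi_lsc adm).
Qed.

Lemma exp_term_measurable (x : R) : measurable_fun setT (exp_term psi x).
Proof.
have me : measurable_fun setT (@expeR R).
  rewrite (_ : expeR = fun y => if y == +oo then +oo else
     if y == -oo then 0 else (expR (fine y))%:E); last first.
    by apply/funext => -[].
  apply: measurable_fun_ifT => //; first exact: measurable_fun_eqe.
  apply: measurable_fun_ifT => //; first exact: measurable_fun_eqe.
  apply/measurable_EFinP; apply: measurableT_comp => //.
apply: measurableT_comp => //.
apply: emeasurable_funB; last exact: psi_measurable.
by apply/measurable_EFinP; exact: measurable_funM.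
Qed.

Lemma measurable_Lam : measurable (Lam lmax).
Proof. by have := @emeasurable_itv R `[0, lmax]; rewrite set_itvcc. Qed.

Lemma ext_exp_term_measurable (x : R) :
  measurable_fun (Lam lmax) (ext_exp_term psi x).
Proof.
pose g (l : \bar R) := if l == +oo then ext_exp_term psi x +oo
  else exp_term psi x (fine l).
apply: (eq_measurable_fun g).
  move=> l /set_mem /LamP[r r0 rl|ly]; last by rewrite /g eqxx.
  by rewrite ext_exp_term_fin.
apply: measurable_funTS; apply: measurable_fun_ifT => //.
  exact: measurable_fun_eqe.
by apply: measurableT_comp => //; exact: exp_term_measurable.
Qed.

(** Negative [l] lie outside the domain of [psi] and contribute -oo to the supremum. Consequently
    the sample space is a down-set. *)
Lemma conjugate_nondecreasing :
  {homo conjugate psi : x y / (x <= y)%R >-> x <= y}.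
Proof.
move=> x y xy; apply: ge_ereal_sup => _ [l _ <-].
have [pl|] := ltP (psi l) +oo; last first.
  by rewrite leye_eq => /eqP ->; exact: leNye.
have [l0 _] := dom_psi_Lam adm pl.
apply: (@le_trans _ _ ((l * y)%:E - psi l)).
  by rewrite leeB// lee_fin ler_wpM2l.
by apply: ereal_sup_ubound; exists l.
Qed.

Lemma sample_space0 : sample_space psi 0%R.
Proof.
rewrite /sample_space /dom /=; apply: (@le_lt_trans _ _ 0) => //.
by apply: ge_ereal_sup => _ [l _ <-];
  rewrite mulr0 sub0e oppe_le0 (psi_ge0 adm).
Qed.

Lemma sample_space_down (x y : R) : (x <= y)%R ->
  sample_space psi y -> sample_space psi x.
Proof. by move=> xy; apply: le_lt_trans; exact: conjugate_nondecreasing. Qed.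

Lemma measurable_sample_space : measurable (sample_space psi).
Proof.
apply: is_interval_measurable => x y _ Xy z /andP[_ zy].
exact: sample_space_down zy Xy.
Qed.

Lemma expeR_conjugate_fin (x : R) : sample_space psi x ->
  expeR (conjugate psi x) \is a fin_num.
Proof.
move=> Xx; rewrite ge0_fin_numE ?expeR_ge0// ltey expeR_eqy.
by rewrite lt_eqF.
Qed.

End ext_exp_term.

(** * Duality for e-variables *)

Lemma mnormalize_mass1 d (T : measurableType d) (R : realType)
    (mu : {measure set T -> \bar R}) (P : probability T R) :
  mu setT = 1 -> mnormalize mu P = mu :> (set T -> \bar R).
Proof.
by move=> mu1; apply/funext => A;
  rewrite /mnormalize mu1 onee_eq0/= invr1 mule1.
Qed.

(** Supplies the finitely supported laws that test e-variables; normalising a sum of point masses of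
    total mass 1 leaves it unchanged. *)
Lemma discrete_probability (R : realType) (N : nat) (v x : nat -> R) :
  (forall k, (0 <= v k)%R) -> (\sum_(k < N) v k = 1)%R ->
  exists mu : probability R R, forall (D : set R) (f : R -> \bar R),
    measurable D -> measurable_fun D f -> (forall y, D y -> 0 <= f y) ->
    \int[mu]_(y in D) f y = \sum_(k < N) (v k)%:E * (\d_(x k) D * f (x k)).
Proof.
move=> v0 v1.
pose m_ k : {measure set R -> \bar R} := mscale (NngNum (v0 k)) \d_(x k).
have m1 : msum m_ N setT = 1.
  rewrite /msum /m_ /= /mscale/= -(congr1 EFin v1) -sumEFin.
  by apply: eq_bigr => k _; rewrite diracT mule1.
exists (mnormalize (msum m_ N) \d_(0%R : R)) => D f mD mf f0.
transitivity (\int[msum m_ N]_(y in D) f y).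
  apply: eq_measure_integral => A mA _.
  exact: (congr1 (fun g : set R -> \bar R => g A) (mnormalize_mass1 _ m1)).
rewrite ge0_integral_measure_sum//; apply: eq_bigr => k _.
by rewrite ge0_integral_mscale// integral_dirac.
Qed.

Section test_measure.
Context (R : realType) (lmax : \bar R) (psi : R -> \bar R).
Hypothesis adm : admissible_psi lmax psi.

(* Normalised to mass below 1 and completed by an atom far to the left, the
   weights w define a sub-psi distribution: near l = 0 the atom wins by
   convexity in l, away from 0 its contribution is negligible. *)
Lemma e_variable_sum_le (h : R -> \bar R) (n : nat) (w d : nat -> R) (s : R) :
  e_variable psi h ->
  (forall i, (0 <= w i)%R) -> (forall i, sample_space psi (d i)) ->
  (forall l, dom psi l ->
    (\sum_(i < n) w i * expR (l * d i - fine (psi l)) <= s)%R) ->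
  \sum_(i < n) (w i)%:E * h (d i) <= s%:E.
Proof.
move=> [mh h0 hP] w0 dX ws.
apply/lee_addgt0Pr => e e0; rewrite -EFinD.
pose W := (\sum_(i < n) w i)%R.
have W0 : (0 <= W)%R by apply: sumr_ge0.
have Ws : (W <= s)%R.
  have : dom psi 0%R by rewrite /dom/= (psi_at0 adm).
  move=> /ws; rewrite (psi_at0 adm)/=; apply: le_trans.
  by apply: ler_sum => i _; rewrite mul0r subr0 expR0 mulr1.
(* The slack [e] makes the normalised mass [m] less than 1, leaving [1 - m] for the extra atom, and
   the weights then use only the fraction [1 - delta] of the bound. *)
set s' := (s + e)%R.
have s'0 : (0 < s')%R by rewrite /s'; lra.
pose m := (W / s')%R; pose delta := (e / s')%R.
have m0 : (0 <= m)%R by rewrite divr_ge0// ltW.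
have m1 : (m < 1)%R by rewrite ltr_pdivrMr// mul1r /s'; lra.
have delta0 : (0 < delta)%R by rewrite divr_gt0.
have sdelta : (s / s' = 1 - delta)%R.
  by rewrite /delta /s'; field; rewrite gt_eqF.
(* Moment generating function of the normalised weights. It equals [m] at 0, so by continuity it is
   below the midpoint of [m] and 1 at some [l0 > 0]. *)
pose f (l : R) := (\sum_(i < n) w i / s' * expR (l * d i))%R.
have f0 : f 0%R = m.
  by rewrite /f /m /W mulr_suml; apply: eq_bigr => i _;
    rewrite mul0r expR0 mulr1.
have [l0 l00 fl0] : exists2 l0 : R, (0 < l0)%R & (f l0 < (1 + m) / 2)%R.
  have fc : f l @[l --> 0%R] --> f 0%R.
    apply: cvg_big; first exact: add_continuous.
    move=> i _; apply: cvgMl_tmp.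
    apply: continuous_cvg; first exact: continuous_expR.
    exact: cvgMr_tmp.
  have /(cvgr_lt _) : f l @[l --> 0^'+] --> f 0%R by exact: cvg_at_right_filter.
  rewrite f0 => /(_ ((1 + m) / 2)%R) => /(_ ltac:(lra)) h1.
  near (0%R : R)^'+ => l.
  by exists l; near: l => //; exact: nbhs_right_gt.
(* The atom [y] is placed so that [expR (l0 * y) = c]: the bound 1/2 keeps the total at [l0] below
   1, and the bound [delta] controls the atom beyond [l0]. *)
pose c := Num.min (2^-1)%R delta.
have c0 : (0 < c)%R by rewrite lt_min delta0 invr_gt0 ltr0n.
have c12 : (c <= 2^-1)%R by rewrite ge_min lexx.
have cd : (c <= delta)%R by rewrite ge_min lexx orbT.
pose y := (ln c / l0)%R.
have yE : expR (l0 * y) = c.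
  by rewrite /y mulrC divfK ?gt_eqF// lnK.
have y0 : (y <= 0)%R.
  by rewrite /y pmulr_lle0 ?invr_gt0// ln_le0//; lra.
have Xy : sample_space psi y := sample_space_down adm y0 (sample_space0 adm).
have key l : dom psi l -> (f l + (1 - m) * expR (l * y))%:E <= expeR (psi l).
  move=> pl; have [ll _] := dom_psi_Lam adm pl.
  have := psi_ge0 adm l; have := ws _ pl; move: pl; rewrite /dom/=.
  case: (psi l) => [p| |]//= _; rewrite !lee_fin => wsl p0.
  have ep : (1 <= expR p)%R by rewrite -expR0 ler_expR.
  (* Up to [l0], chords bound the total by 1, its value at 0. Beyond [l0], the weights take
     [1 - delta] of [expR p] and the atom at most [delta]. *)
  have [ll0|ll0] := leP l l0.
    apply: le_trans ep.
    pose t := (l / l0)%R.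
    have t01 : (0 <= t <= 1)%R.
      by rewrite /t divr_ge0 ?(ltW l00)//= ler_pdivrMr// mul1r.
    have cvx z : (expR (l * z) <= (1 - t) + t * expR (l0 * z))%R.
      have := expR_convex 0%R (l0 * z) t01; rewrite expR0 mulr1.
      by apply: le_trans; rewrite ler_expR subr0 add0r mulrA divfK ?gt_eqF.
    have fl : (f l <= (1 - t) * m + t * f l0)%R.
      rewrite -f0 /f !mulr_sumr -big_split/=; apply: ler_sum => i _.
      rewrite mul0r expR0 mulr1.
      have wi : (0 <= w i / s')%R by rewrite divr_ge0// ltW.
      apply: le_trans (ler_wpM2l wi (cvx (d i))) _.
      by rewrite le_eqVlt; apply/orP; left; apply/eqP; ring.
    have := cvx y; rewrite yE => cvy.
    move: t01 fl => /andP[t0 t1] fl.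
    have tc : (t * c <= t / 2)%R by rewrite ler_wpM2l.
    have cvy2 : ((1 - m) * expR (l * y) <= (1 - m) * (1 - t / 2))%R.
      by rewrite ler_wpM2l; lra.
    have tf : (t * f l0 <= t * ((1 + m) / 2))%R by rewrite ler_wpM2l// ltW.
    by move: fl cvy2 tf; lra.
  have flp : (f l <= (1 - delta) * expR p)%R.
    rewrite -sdelta mulrAC ler_pdivlMr// /f.
    apply: le_trans (ler_wpM2r (expR_ge0 p) wsl).
    rewrite !mulr_suml le_eqVlt; apply/orP; left; apply/eqP.
    apply: eq_bigr => i _.
    by rewrite expRD expRN; field; rewrite !gt_eqF ?expR_gt0.
  have : (expR (l * y) <= c)%R.
    by rewrite -yE ler_expR ler_wnM2r// ltW.
  by have := expR_gt0 (l * y); nra.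
pose v k := if (k < n)%N then (w k / s')%R else (1 - m)%R.
pose x k := if (k < n)%N then d k else y.
have vO (i : 'I_n) : v i = (w i / s')%R by rewrite /v ltn_ord.
have xO (i : 'I_n) : x i = d i by rewrite /x ltn_ord.
have vn : v n = (1 - m)%R by rewrite /v ltnn.
have xn : x n = y by rewrite /x ltnn.
have v0 k : (0 <= v k)%R.
  by rewrite /v; case: ifP => _; [rewrite divr_ge0// ltW|lra].
have v1 : (\sum_(k < n.+1) v k = 1)%R.
  rewrite big_ord_recr/= vn (eq_bigr _ (fun i _ => vO i)) -mulr_suml -/W -/m.
  by lra.
have xX k : sample_space psi (x k) by rewrite /x; case: ifP.
have [mu muE] := discrete_probability x v0 v1.
have mX := measurable_sample_space adm.
have muP : null_hypothesis psi mu.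
  split.
    have mXC := measurableC mX.
    have := muE _ (cst 1) mXC (measurable_cst _) (fun _ _ => lee01).
    rewrite integral_cst// mul1e /measure_on => ->; rewrite big1// => k _.
    have nXk : ~ (~` sample_space psi) (x k) by apply; exact: xX.
    by rewrite diracE memNset// mul0e mule0.
  move=> l pl.
  have me : measurable_fun setT (fun z : R => (expR (l * z))%:E).
    apply/measurable_EFinP; apply: measurableT_comp => //.
  have e0' : forall z : R, setT z -> 0 <= (expR (l * z))%:E.
    by move=> z _; rewrite lee_fin expR_ge0.
  rewrite (muE _ _ measurableT me e0') big_ord_recr/= vn xn.
  under eq_bigr => k _ do rewrite vO xO diracT mul1e -EFinM.
  by rewrite sumEFin diracT mul1e -EFinM -EFinD; exact: key.
(* Drop the nonnegative contribution of the extra atom, then multiply by [s']. *)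
have := hP _ muP; rewrite muE// => hle.
have {}hle : \sum_(i < n) (w i / s')%:E * h (d i) <= 1.
  apply: le_trans hle; rewrite big_ord_recr/=.
  rewrite [leRHS](_ : _ = \sum_(i < n) (w i / s')%:E * h (d i) +
     (v n)%:E * h (x n)).
    by rewrite leeDl// mule_ge0// ?lee_fin//; exact: h0.
  congr (_ + _); last by rewrite diracE mem_set ?mul1e.
  by apply: eq_bigr => i _; rewrite vO xO diracE mem_set ?mul1e.
have s'E : s'%:E * 1 = s'%:E by rewrite mule1.
rewrite -s'E; apply: le_trans (lee_wpmul2l _ hle); last by rewrite lee_fin ltW.
rewrite ge0_sume_distrr; last first.
  by move=> i _; rewrite mule_ge0 ?h0// lee_fin divr_ge0// ltW.
apply: lee_sum => i _; rewrite muleA -EFinM.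
by rewrite mulrC divfK ?gt_eqF.
Unshelve. all: end_near. Qed.

(** Duality with a single unit weight at [x]. In particular e-variables are finite on the sample
    space. *)
Lemma e_variable_le_conjugate (h : R -> \bar R) (x : R) :
  e_variable psi h -> sample_space psi x -> h x <= expeR (conjugate psi x).
Proof.
move=> he Xx.
have fc := expeR_conjugate_fin Xx.
have := @e_variable_sum_le h 1 (fun=> 1%R) (fun=> x) (fine (expeR (conjugate
  psi x))) he.
rewrite big_ord1 mul1e fineK//; apply=> // l pl.
rewrite big_ord1 mul1r -lee_fin fineK// -(exp_termE adm)//.
exact: exp_term_le_conjugate.
Qed.

End test_measure.

(** * Mixtures encoded by quantile functions *)

(** Induction over the cells [[k/N, (k+1)/N[], on which the index is [k]; the cap [N.-1] acts only
    from [t = 1] on. *)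
Lemma integral_step_function (R : realType) (N : nat) (G : nat -> \bar R) :
  (0 < N)%N -> (forall k, 0 <= G k) ->
  measurable_fun setT (fun t : R => G (minn (Num.truncn (N%:R * t)) N.-1)) ->
  \int[uniform_prob (@ltr01 R)]_t G (minn (Num.truncn (N%:R * t)%R) N.-1) =
    (N%:R^-1)%:E * \sum_(k < N) G k.
Proof.
move=> N0 G0 mG; set F := fun t : R => _ in mG *.
have NR : (0 < N%:R :> R)%R by rewrite ltr0n.
have F0 t : 0 <= F t by exact: G0.
rewrite integral_uniform// subr0 invr1 mul1e -integral_itv_bndo_bndc;
  last first.
  exact: measurable_funTS.
suff step k : (k <= N)%N ->
  \int[lebesgue_measure]_(t in `[0%R, (k%:R / N%:R)%R[) F t =
    (N%:R^-1)%:E * \sum_(j < k) G j.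
  by have := step N (leqnn N); rewrite divff ?gt_eqF.
elim: k => [_|k IH kN].
  by rewrite mul0r set_itvco0 integral_set0 big_ord0 mule0.
have kk : (k%:R / N%:R <= k.+1%:R / N%:R :> R)%R by rewrite ler_pM2r
  ?invr_gt0// ler_nat.
rewrite (_ : `[0%R, (k.+1%:R / N%:R)%R[%classic =
    `[0%R, (k%:R / N%:R)%R[ `|` `[(k%:R / N%:R)%R, (k.+1%:R / N%:R)%R[ :> set
      R); last first.
  by rewrite -itv_bndbnd_setU// bnd_simp// divr_ge0.
rewrite ge0_integral_setU//; first last.
- apply/disj_setPS => y [/=]; rewrite 2!in_itv/= => /andP[_ yk] /andP[].
  by rewrite leNgt yk.
- exact: measurable_funTS.
rewrite IH 1?ltnW// big_ord_recr/= ge0_muleDr ?sume_ge0//; congr (_ + _).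
rewrite (eq_integral (cst (G k))); last first.
  move=> t; rewrite inE/= in_itv/= => /andP[kt tk]; rewrite /F.
  rewrite (@truncn_def _ _ k); last first.
    by rewrite mulrC -ler_pdivrMr// kt -ltr_pdivlMr.
  by rewrite (minn_idPl _)// -ltnS prednK.
rewrite integral_cst//= lebesgue_measure_itv/= lte_fin.
rewrite ltr_pM2r ?invr_gt0// ltr_nat ltnSn muleC; congr (_ * _).
by rewrite -EFinB -mulrBl -natr1 addrAC subrr add0r mul1r.
Qed.

Lemma integral_uniform_cst (R : realType) (c : \bar R) :
  \int[uniform_prob (@ltr01 R)]_t cst c t = c.
Proof.
rewrite integral_cst//.
have := @probability_setT _ _ _ (uniform_prob (@ltr01 R)).
by move=> /= ->; rewrite mule1.
Qed.

Section quantile_mixture.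
Context (R : realType) (lmax : \bar R) (psi : R -> \bar R).
Hypothesis adm : admissible_psi lmax psi.

(** Taken on the whole line, although the uniform law only sees the unit interval, so that the
    selection theorem applies directly. *)
Definition quantile (q : R -> \bar R) : Prop :=
  {homo q : x y / (x <= y)%R >-> x <= y} /\ forall t, Lam lmax (q t).

(* The mixture whose mixing measure is the law of q under the uniform
   distribution, i.e. has quantile function q. *)
Definition quantile_mixture (q : R -> \bar R) (x : R) : \bar R :=
  \int[uniform_prob (@ltr01 R)]_t ext_exp_term psi x (q t).

Lemma ext_exp_term_quantile_measurable q x : quantile q ->
  measurable_fun setT (fun t => ext_exp_term psi x (q t)).
Proof.
move=> [qm qL]; apply: (measurable_comp (measurable_Lam lmax)).
- by move=> _ [t _ <-]; exact: qL.
- exact: (ext_exp_term_measurable adm).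
- exact: nondecreasing_emeasurable.
Qed.

Lemma quantile_mixture_ge0 q x : quantile q -> 0 <= quantile_mixture q x.
Proof.
by move=> [_ qL]; apply: integral_ge0 => t _; exact: (ext_exp_term_ge0 adm).
Qed.

Lemma quantile_mixture_nondecreasing q : quantile q ->
  {homo quantile_mixture q : x y / (x <= y)%R >-> x <= y}.
Proof.
move=> hq x y xy; have [_ qL] := hq.
apply: ge0_le_integral => //.
- by move=> t _; exact: (ext_exp_term_ge0 adm).
- exact: ext_exp_term_quantile_measurable.
- exact: ext_exp_term_quantile_measurable.
- by move=> t _; exact: (ext_exp_term_nondecreasing adm).
Qed.

Lemma quantile_mixture_secant q (x z t : R) : quantile q -> (0 <= t <= 1)%R ->
  quantile_mixture q (x + t * (z - x))%R <=
    quantile_mixture q x + t%:E * quantile_mixture q z.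
Proof.
move=> hq t01; have [_ qL] := hq; have /andP[t0 _] := t01.
have e0 y s : 0 <= ext_exp_term psi y (q s) by exact: (ext_exp_term_ge0 adm).
have me y := ext_exp_term_quantile_measurable y hq.
rewrite /quantile_mixture -ge0_integralZl//.
have tg0 s : 0 <= t%:E * ext_exp_term psi z (q s) by rewrite mule_ge0.
have mtg : measurable_fun setT (fun s => t%:E * ext_exp_term psi z (q s)).
  exact: measurable_funeM.
rewrite -ge0_integralD//.
apply: ge0_le_integral => //.
- exact: me.
- by apply: emeasurable_funD => //; exact: me.
- by move=> s _; exact: (ext_exp_term_secant adm).
- exact: me.
- exact: me.
Qed.

(** Dominated convergence: the integrand is continuous on [Lam lmax], a countable set is null for
    the uniform law, and the constant bound [expeR (conjugate psi x)] is finite. *)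
Lemma quantile_mixture_cvg (q_ : nat -> R -> \bar R) (q : R -> \bar R) x :
  sample_space psi x -> (forall n, quantile (q_ n)) -> quantile q ->
  countable [set t | ~ (q_ n t @[n --> \oo] --> q t)] ->
  quantile_mixture (q_ n) x @[n --> \oo] --> quantile_mixture q x.
Proof.
move=> Xx hq_ hq cq; have [_ qL] := hq.
have mN : measurable [set t | ~ (q_ n t @[n --> \oo] --> q t)].
  exact: countable_measurable.
have [] := @dominated_convergence _ _ _ (uniform_prob (@ltr01 R)) setT
  measurableT (fun n t => ext_exp_term psi x (q_ n t))
  (fun t => ext_exp_term psi x (q t)) (cst (expeR (conjugate psi x))) => //.
- by move=> n; exact: ext_exp_term_quantile_measurable.
- exact: ext_exp_term_quantile_measurable.
- exists [set t | ~ (q_ n t @[n --> \oo] --> q t)]; split => //.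
    have /null_content_dominatesP := @dominates_uniform_prob R 0%R 1%R ltr01.
    by apply=> //; exact: countable_lebesgue_measure0.
  move=> t /= h cvt; apply: h => _.
  by apply: (ext_exp_term_cvg adm) => // n; have [_] := hq_ n.
- apply/integrableP; split => //.
  rewrite (eq_integral (cst (expeR (conjugate psi x)))); last first.
    by move=> t _; rewrite gee0_abs ?expeR_ge0.
  rewrite integral_uniform_cst.
  by rewrite -ge0_fin_numE ?expeR_ge0//; exact: expeR_conjugate_fin.
- apply: aeW => t n _; have [_ qLn] := hq_ n.
  rewrite gee0_abs; last exact: (ext_exp_term_ge0 adm).
  exact: (ext_exp_term_le_conjugate adm).
Qed.

(** The uniform law on the entries of [s], with multiplicity, has as quantile function the step
    function through the sorted list. *)
Lemma quantile_average (s : seq R) : (0 < size s)%N ->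
  (forall l, l \in s -> dom psi l) ->
  exists2 q, quantile q & forall x, quantile_mixture q x =
    ((size s)%:R^-1 * \sum_(l <- s) expR (l * x - fine (psi l)))%:E.
Proof.
move=> s0 sdom; set N := size s.
pose r := sort <=%R s.
have rN : size r = N by rewrite size_sort.
pose k (t : R) := minn (Num.truncn (N%:R * t)) N.-1.
have kN t : (k t < N)%N by rewrite /k -[ltnRHS]prednK// ltnS geq_minr.
have rdom j : (j < N)%N -> dom psi (nth 0%R r j).
  by move=> jN; apply: sdom; rewrite -(mem_sort <=%R) mem_nth ?rN.
have hq : quantile (fun t => (nth 0%R r (k t))%:E).
  split=> [x y xy|t].
    rewrite lee_fin; apply: (sorted_leq_nth le_trans le_refl) => //.
    + exact: sort_le_sorted.
    + by rewrite inE rN.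
    + by rewrite inE rN.
    + rewrite /k leq_min geq_minr andbT (leq_trans (geq_minl _ _))//.
      by rewrite le_truncn// ler_wpM2l.
  have [l0 ll] := dom_psi_Lam adm (rdom _ (kN t)).
  by rewrite /Lam/= lee_fin l0.
exists (fun t => (nth 0%R r (k t))%:E) => // x.
pose G j := ext_exp_term psi x (nth 0%R r (minn j N.-1))%:E.
have jN j : (minn j N.-1 < N)%N by rewrite -[ltnRHS]prednK// ltnS geq_minr.
have GE j : G j = (expR (nth 0%R r (minn j N.-1) * x -
    fine (psi (nth 0%R r (minn j N.-1)))))%:E.
  have [l0 ll] := dom_psi_Lam adm (rdom _ (jN j)).
  by rewrite /G (ext_exp_term_fin adm)// (exp_termE adm)//; exact: rdom.
have GkE t : ext_exp_term psi x (nth 0%R r (k t))%:E = G (k t).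
  by rewrite /G /k -minnA minnn.
transitivity (\int[uniform_prob (@ltr01 R)]_t G (k t)).
  by apply: eq_integral => t _; rewrite GkE.
rewrite /k integral_step_function//; last 2 first.
- by move=> j; rewrite GE lee_fin expR_ge0.
- have := ext_exp_term_quantile_measurable x hq.
  by apply: eq_measurable_fun => t _; rewrite GkE.
rewrite EFinM -sumEFin; congr (_ * _).
rewrite -(perm_big _ (permEl (perm_sort <=%R s)))/= -/r.
rewrite (big_nth 0%R) rN big_mkord; apply: eq_bigr => j _.
by rewrite GE (minn_idPl _)// -ltnS prednK.
Qed.

End quantile_mixture.

(** Combines duality, greedy averaging and compactness to dominate an arbitrary e-variable by a
    mixture that is itself an e-variable. *)
Section e_variable_domination.
Context (R : realType) (lmax : \bar R) (psi : R -> \bar R).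
Hypothesis adm : admissible_psi lmax psi.

Lemma e_variable_fin_num (h : R -> \bar R) (x : R) :
  e_variable psi h -> sample_space psi x -> h x \is a fin_num.
Proof.
move=> he Xx; have [_ h0 _] := he; rewrite ge0_fin_numE ?h0//.
apply: le_lt_trans (e_variable_le_conjugate adm he Xx) _.
by rewrite -ge0_fin_numE ?expeR_ge0//; exact: expeR_conjugate_fin.
Qed.

(** Fatou's lemma under each null law. *)
Lemma e_variable_cvg (h_ : nat -> R -> \bar R) (h : R -> \bar R) :
  (forall n, e_variable psi (h_ n)) ->
  (forall x, sample_space psi x -> h_ n x @[n --> \oo] --> h x) ->
  e_variable psi h.
Proof.
move=> he hcv; have mX := measurable_sample_space adm.
have mh n : measurable_fun (sample_space psi) (h_ n) by have [] := he n.
have h0 n x : sample_space psi x -> 0 <= h_ n x by have [_ + _] := he n; apply.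
have hE x : sample_space psi x -> h x = limn (h_ ^~ x).
  by move=> Xx; apply/esym/cvg_lim => //; exact: hcv.
split.
- by apply: emeasurable_fun_cvg mh _ => x Xx; exact: hcv.
- move=> x Xx; rewrite hE//; apply: lime_ge.
    by apply/cvg_ex; eexists; exact: hcv Xx.
  by apply: nearW => n; exact: h0.
- move=> mu muP.
  rewrite (eq_integral (fun x => limn_einf (h_ ^~ x))); last first.
    move=> x /set_mem Xx; rewrite hE// is_cvg_limn_einfE//.
    by apply/cvg_ex; eexists; exact: hcv Xx.
  apply: le_trans (fatou mu mX mh h0) _.
  rewrite limn_einf_lim; apply: lime_le; first exact: is_cvg_einfs.
  apply: nearW => n; apply: ge_ereal_inf.
  exists (\int[mu]_(x in sample_space psi) h_ n x); first by exists n => /=.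
  by have [_ _] := he n; apply.
Qed.

(** The sub-psi condition says that each exponential with [l] in the domain integrates to at most 1,
    and averaging preserves this. *)
Lemma e_variable_average (s : seq R) : (0 < size s)%N ->
  (forall l, l \in s -> dom psi l) ->
  e_variable psi (fun x =>
    ((size s)%:R^-1 * \sum_(l <- s) expR (l * x - fine (psi l)))%:E).
Proof.
move=> s0 sdom; have mX := measurable_sample_space adm.
have N0 : (0 < (size s)%:R :> R)%R by rewrite ltr0n.
pose f l x : \bar R := (expR (l * x - fine (psi l)))%:E.
have f0 l x : 0 <= f l x by rewrite lee_fin expR_ge0.
have mf l : measurable_fun setT (f l).
  by apply/measurable_EFinP; apply: measurableT_comp => //;
    exact: measurable_funB.
have E x : ((size s)%:R^-1 * \sum_(l <- s) expR (l * x - fine (psi l)))%:E =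
    ((size s)%:R^-1)%:E * \sum_(l <- s) f l x by rewrite EFinM -sumEFin.
have mfs : measurable_fun setT (fun x => \sum_(l <- s) f l x).
  exact: emeasurable_sum.
have fs0 x : 0 <= \sum_(l <- s) f l x by exact: sume_ge0.
split.
- under eq_fun do rewrite E.
  by apply: measurable_funTS; exact: measurable_funeM.
- move=> x _; rewrite lee_fin mulr_ge0// ?invr_ge0//.
  by apply: sumr_ge0 => l _; exact: expR_ge0.
- move=> mu [_ muP].
  under eq_integral do rewrite E.
  apply: (@le_trans _ _ (\int[mu]_x (((size s)%:R^-1)%:E * \sum_(l <- s) f l
    x))).
    apply: ge0_subset_integral => //; first exact: measurable_funeM.
    by move=> x _; rewrite mule_ge0// lee_fin invr_ge0.
  rewrite ge0_integralZl//.
  rewrite ge0_integral_sum//.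
  rewrite lee_pdivrMl// mule1.
  apply: (@le_trans _ _ (\sum_(l <- s) 1)); last first.
    by rewrite sumEFin lee_fin big_const_seq count_predT iter_addr_0.
  rewrite big_seq [leRHS]big_seq; apply: lee_sum => l /sdom pl.
  have := muP _ pl; have := psi_ge0 adm l; move: pl; rewrite /dom/= /f.
  case: (psi l) => [p| |]//= _ p0 hl.
  under eq_integral do rewrite expRD expRN mulrC EFinM.
  rewrite ge0_integralZl//.
  + by rewrite lee_pdivrMl ?expR_gt0// mule1.
  + apply/measurable_EFinP; apply: measurableT_comp => //.
Qed.

Lemma quantile_mixture_compact (q_ : nat -> R -> \bar R) :
  (forall n, quantile lmax (q_ n)) ->
  (forall n, e_variable psi (quantile_mixture psi (q_ n))) ->
  exists (phi : nat -> nat) (q : R -> \bar R),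
    [/\ forall k, (k <= phi k)%N, quantile lmax q,
      e_variable psi (quantile_mixture psi q) &
      forall x, sample_space psi x ->
        quantile_mixture psi (q_ (phi k)) x @[k --> \oo] -->
        quantile_mixture psi q x].
Proof.
move=> hq he.
have [phi [q [phik qm qL cq]]] := helly_selection (ltW (lmax_gt0 adm))
  (fun n => (hq n).1) (fun n => (hq n).2).
have cv x : sample_space psi x ->
    quantile_mixture psi (q_ (phi k)) x @[k --> \oo] -->
    quantile_mixture psi q x.
  by move=> Xx; exact: (quantile_mixture_cvg adm Xx (fun k => hq (phi k))).
exists phi, q; split => //.
exact: (@e_variable_cvg (fun k => quantile_mixture psi (q_ (phi k)))).
Qed.

(** If some weights [w] violated the hypothesis of the greedy lemma, duality with [s] equal to the
    weighted sum of [h] minus 1 would bound that sum by itself minus 1. *)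
Lemma e_variable_finitely_dominated (h : R -> \bar R) (d : nat -> R) (n : nat)
    (e : R) : e_variable psi h -> (forall i, sample_space psi (d i)) ->
  (0 < e)%R ->
  exists q, [/\ quantile lmax q, e_variable psi (quantile_mixture psi q) &
    forall i, (i < n)%N -> (fine (h (d i)) - e)%:E <= quantile_mixture psi q (d
      i)].
Proof.
move=> he dX e0.
pose T := {l : R | dom psi l}.
pose a (l : T) (i : 'I_n) : R := expR (sval l * d i - fine (psi (sval l))).
have aE l i : (a l i)%:E = exp_term psi (d i) (sval l).
  by rewrite (exp_termE adm)//; exact: (svalP l).
have ha (l : T) (i : 'I_n) :
    (`|a l i| <= \sum_(j < n) fine (expeR (conjugate psi (d j))))%R.
  rewrite ger0_norm ?expR_ge0// (bigD1 i)//=.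
  rewrite -[leLHS]addr0 lerD//; last first.
    by apply: sumr_ge0 => j _; rewrite fine_ge0// expeR_ge0.
  rewrite -lee_fin aE fineK; first exact: exp_term_le_conjugate.
  exact: expeR_conjugate_fin.
have sep (w : 'I_n -> R) : (forall i, (0 <= w i)%R) ->
    exists t, (\sum_i w i * fine (h (d i)) <= \sum_i w i * a t i + 1)%R.
  move=> w0; apply: contrapT => /forallNP nw.
  pose w' k := if insub k is Some i then w i else 0%R.
  have w'E (i : 'I_n) : w' i = w i by rewrite /w' valK.
  have w'0 k : (0 <= w' k)%R by rewrite /w'; case: insubP.
  have prem l : dom psi l -> (\sum_(i < n) w' i * expR (l * d i - fine (psi l))
      <= \sum_i w i * fine (h (d i)) - 1)%R.
    move=> pl; have := nw (exist _ l pl) => /negP; rewrite -ltNge => nwl.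
    rewrite lerBrDr; apply: ltW; apply: le_lt_trans nwl.
    by rewrite lerD2r; apply: ler_sum => i _; rewrite w'E.
  have := e_variable_sum_le adm he w'0 dX prem.
  have -> : \sum_(i < n) (w' i)%:E * h (d i) =
      (\sum_i w i * fine (h (d i)))%:E.
    rewrite -sumEFin; apply: eq_bigr => i _.
    by rewrite w'E EFinM fineK//; exact: e_variable_fin_num.
  by rewrite lee_fin lerBrDr gerDl ler10.
have [s [s0 hs]] := uniform_average_dominates ha sep e0.
pose s' := map sval s.
have s'0 : (0 < size s')%N by rewrite size_map.
have s'dom l : l \in s' -> dom psi l.
  by move=> /mapP[t _ ->]; exact: svalP t.
have [q hq qE] := quantile_average adm s'0 s'dom.
exists q; split => //.
  by rewrite (funext qE); exact: e_variable_average.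
move=> i ni; rewrite qE lee_fin size_map big_map.
exact: (hs (Ordinal ni)).
Qed.

(* Domination on countably many points suffices: for rational b and r one point
   y < b with h y > r, whenever there is one. The mixture is nondecreasing, and
   right-continuous at x by convexity unless x is the maximum of the space. *)
Lemma e_variable_dominated (h : R -> \bar R) : e_variable psi h ->
  exists q, [/\ quantile lmax q, e_variable psi (quantile_mixture psi q) &
    forall x, sample_space psi x -> h x <= quantile_mixture psi q x].
Proof.
move=> he.
have pick (p : rat * rat) : exists y, sample_space psi y /\
    ((exists z, [/\ sample_space psi z, (z < ratr p.1)%R &
        (ratr p.2)%:E < h z]) ->
      (y < ratr p.1)%R /\ (ratr p.2)%:E < h y).
  have [[z [Xz zp hz]]|nz] := pselect (exists z, [/\ sample_space psi z,
    (z < ratr p.1)%R & (ratr p.2)%:E < h z]); first by exists z.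
  by exists 0%R; split => //; exact: (sample_space0 adm).
have [g gP] := choice pick.
pose d j := if unpickle j is Some p then g p else 0%R.
have dX j : sample_space psi (d j).
  rewrite /d; case: unpickle => [p|]; last exact: (sample_space0 adm).
  by have [] := gP p.
(* Stage [n] handles the first [n] points with error [1/(n+1)]; in the limit every point is
   dominated without error. *)
have [q_ q_P] := choice (fun n => @e_variable_finitely_dominated h d n
  (n.+1%:R^-1)%R he dX (ltac:(by rewrite invr_gt0 ltr0n))).
have hq_ n : quantile lmax (q_ n) by have [] := q_P n.
have he_ n : e_variable psi (quantile_mixture psi (q_ n)) by have [] := q_P n.
have [phi [q [phik hq heq cv]]] := quantile_mixture_compact hq_ he_.
exists q; split => //.
have dom_d j : h (d j) <= quantile_mixture psi q (d j).
  apply/lee_addgt0Pr => e e0; rewrite -leeBlDr//.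
  rewrite -(cvg_lim _ (cv _ (dX j)))//; apply: lime_ge.
    by apply/cvg_ex; eexists; exact: cv.
  near=> k.
  have [_ _ /(_ j)] := q_P (phi k).
  have jk : (j < phi k)%N by apply: leq_trans (phik k); near: k;
    exact: nbhs_infty_gt.
  move=> /(_ jk); apply: le_trans.
  rewrite -[h (d j)]fineK ?e_variable_fin_num// -EFinB lee_fin lerD2l lerN2.
  apply: (@le_trans _ _ (k.+1%:R^-1)%R).
    by rewrite lef_pV2 ?posrE ?ltr0n// ler_nat ltnS.
  apply: ltW; near: k; exact: (near_infty_natSinv_lt (PosNum e0)).
have dom_g p : h (g p) <= quantile_mixture psi q (g p).
  by have := dom_d (pickle p); rewrite /d pickleK.
move=> x Xx; rewrite leNgt; apply/negP => /ereal_lt_rat[r /andP[qr rh]].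
have [[z [Xz xz]]|nz] := pselect (exists z, sample_space psi z /\ (x < z)%R).
  have qf y : sample_space psi y -> quantile_mixture psi q y \is a fin_num.
    exact: e_variable_fin_num.
  have qz0 := quantile_mixture_ge0 adm z hq.
  (* The point [x] itself witnesses the search for any rational [b > x]. Monotonicity carries the
     level [r] to [x + t (z - x)], and the secant bound back to [x]; a small [t] then contradicts
     the choice of [r]. *)
  have above t : (0 < t <= 1)%R -> (ratr r)%:E <
      quantile_mixture psi q x + t%:E * quantile_mixture psi q z.
    move=> /andP[t0 t1].
    have xb : (x < x + t * (z - x))%R by rewrite ltrDl mulr_gt0// subr_gt0.
    apply: lt_le_trans (quantile_mixture_secant adm x z hq _);
      last by rewrite ltW.
    have [b] := rat_in_itvoo xb; rewrite in_itv/= => /andP[xb' bb].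
    have [_ gy] := gP (b, r).
    have [|yb ry] := gy; first by exists x.
    apply: lt_le_trans ry (le_trans (dom_g _) _).
    by apply: (quantile_mixture_nondecreasing adm hq);
      rewrite ltW// (lt_trans yb).
  move: above qr qz0; rewrite -(fineK (qf x Xx)) -(fineK (qf z Xz)).
  move: (fine _) (fine _) => v u above; rewrite !lte_fin lee_fin => ur v0.
  have v1 : (0 < v + 1)%R by rewrite ltr_wpDl.
  pose t := Num.min 1%R ((ratr r - u) / (v + 1))%R.
  have t0 : (0 < t)%R by rewrite lt_min ltr01 divr_gt0// subr_gt0.
  have t1 : (t <= 1)%R by rewrite ge_min lexx.
  have : (t <= (ratr r - u) / (v + 1))%R by rewrite ge_min lexx orbT.
  rewrite ler_pdivlMr// => tv.
  have := above t; rewrite t0 t1 -EFinM -EFinD lte_fin => /(_ isT).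
  by move: tv t0; lra.
(* Here [x] is the maximum of the space, so the selected point is at most [x] and monotonicity
   suffices. *)
have [b] := rat_in_itvoo (ltac:(by rewrite ltrDl) : (x < x + 1)%R).
rewrite in_itv/= => /andP[xb _].
have [Xy gy] := gP (b, r).
have [|yb ry] := gy; first by exists x.
have yx : (g (b, r) <= x)%R.
  by rewrite leNgt; apply/negP => xy; apply: nz; exists (g (b, r)).
have := lt_trans qr (lt_le_trans ry (dom_g _)).
by rewrite ltNge (quantile_mixture_nondecreasing adm hq).
Unshelve. all: end_near. Qed.

End e_variable_domination.

(** * Semicontinuity of the objective *)

Lemma limn_einf_ge_near (R : realType) (u : nat -> \bar R) (c : \bar R) :
  (\forall k \near \oo, c <= u k) -> c <= limn_einf u.
Proof.
move=> [N _ Nu]; rewrite limn_einf_lim (cvg_lim _ (@cvg_einfs_sup _ u))//.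
apply: (@le_trans _ _ (einfs u N)).
  by apply: le_ereal_inf_tmp => _ [k /= Nk <-]; exact: Nu.
by apply: ereal_sup_ubound; exists N.
Qed.

Lemma limn_einf_le_near (R : realType) (u : nat -> \bar R) (c : \bar R) :
  (\forall k \near \oo, u k <= c) -> limn_einf u <= c.
Proof.
move=> uc; rewrite limn_einf_lim; apply: lime_le; first exact: is_cvg_einfs.
apply: filterS uc => k; apply: le_trans.
by apply: ereal_inf_lbound; exists k => /=.
Qed.

(** Term [n] exceeds those among the first [n] coded rationals that lie below the supremum, which
    covers finite and infinite suprema at once. *)
Lemma ereal_sup_seq (R : realType) (A : set (\bar R)) : A !=set0 ->
  exists2 u : nat -> \bar R, (forall n, A (u n)) &
    forall c : R, c%:E < ereal_sup A -> \forall n \near \oo, c%:E < u n.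
Proof.
move=> [a0 Aa0].
have step n : exists a, A a /\ forall j, (j < n)%N ->
    if unpickle j is Some r then
      (ratr (r : rat))%:E < ereal_sup A -> (ratr r)%:E < a else True.
  elim: n => [|n [a [Aa IH]]]; first by exists a0.
  case En : (unpickle n) => [r|]; last first.
    exists a; split => // j; rewrite ltnS leq_eqVlt => /predU1P[->|/IH//].
    by rewrite En.
  have [/ereal_sup_gtP[b Ab rb]|rA] := ltP (ratr r)%:E (ereal_sup A);
    last first.
    exists a; split => // j; rewrite ltnS leq_eqVlt => /predU1P[->|/IH//].
    by rewrite En ltNge rA.
  exists (maxe a b); split; first by rewrite /maxe; case: ifP.
  move=> j; rewrite ltnS leq_eqVlt => /predU1P[->|/IH].
    by rewrite En lt_max rb orbT.
  by case: unpickle => // r' h /h; rewrite lt_max => ->.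
have [u uP] := choice step.
exists u => [n|c cA]; first by have [] := uP n.
have [r /andP[cr rA]] := ereal_lt_rat cA.
exists (pickle r).+1 => // n /= rn; apply: lt_trans cr _.
by have [_ /(_ _ rn)] := uP n; rewrite pickleK; exact.
Qed.

Section majorized_integral.
Context d (T : measurableType d) (R : realType).
Variables (mu : {measure set T -> \bar R}) (D : set T).
Hypothesis mD : measurable D.
Variables (u : T -> \bar R) (g : T -> R).
Hypothesis mu_ : measurable_fun D u.
Hypothesis ig : mu.-integrable D (EFin \o g).
Hypothesis ug : forall x, D x -> u x <= (g x)%:E.

(** Expresses the -oo convention through the nonnegative [g - u], to which Fatou's lemma applies.
    The bounds [u^- <= (g - u) + |g|] and [|u| <= |g| + u^-] settle the two cases. *)
Lemma majorized_integralE :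
  (if \int[mu]_(x in D) u^\- x == +oo then -oo else \int[mu]_(x in D) u x) =
  \int[mu]_(x in D) (g x)%:E - \int[mu]_(x in D) ((g x)%:E - u x).
Proof.
have gfin := integrable_fin_num mD ig.
have mg := measurable_int mu ig.
have /integrableP[_ iabs] := ig.
have gu0 x : D x -> 0 <= (g x)%:E - u x by move=> Dx; rewrite subre_ge0 ?ug.
have mgu : measurable_fun D (fun x =>
  (g x)%:E - u x) by exact: emeasurable_funB.
have mabs : measurable_fun D (fun x => `|(g x)%:E|) by exact: measurableT_comp.
have mneg := measurable_funeneg mu_.
have [uy|uy] := eqVneq (\int[mu]_(x in D) u^\- x) +oo.
  suff -> : \int[mu]_(x in D) ((g x)%:E - u x) = +oo by rewrite addeNy.
  apply/eqP; rewrite -leye_eq leNgt; apply/negP => gulty.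
  suff : \int[mu]_(x in D) u^\- x < +oo by rewrite uy.
  apply: (@le_lt_trans _ _
    (\int[mu]_(x in D) (((g x)%:E - u x) + `|(g x)%:E|))).
    apply: ge0_le_integral => //.
    - exact: emeasurable_funD.
    - move=> x Dx; rewrite funenegE.
      have := ug Dx; case: (u x) => [r| |]//=; rewrite ?lee_fin => hr.
        rewrite -EFin_max -EFinB -EFinD lee_fin.
        have := ler_norm (- g x)%R; have := normr_ge0 (g x).
        by rewrite normrN ge_max => n0 n1; apply/andP; split; lra.
  by rewrite ge0_integralD// lte_add_pinfty.
have uneg : \int[mu]_(x in D) u^\- x < +oo by rewrite ltey.
have iu : mu.-integrable D u.
  apply/integrableP; split => //.
  apply: (@le_lt_trans _ _ (\int[mu]_(x in D) (`|(g x)%:E| + u^\- x))).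
    apply: ge0_le_integral => //.
    - exact: measurableT_comp.
    - exact: emeasurable_funD.
    - move=> x Dx; rewrite funenegE.
      have := ug Dx; case: (u x) => [r| |]//=; rewrite ?lee_fin => hr.
        rewrite -EFin_max -EFinD lee_fin.
        have := ler_norm (g x); have := normr_ge0 (g x).
        rewrite -lerBlDl le_max => n0 n1; apply/orP.
        by have [r0|r0] := leP 0%R r; [right|left];
          [rewrite ger0_norm//; lra|rewrite ltr0_norm//; lra].
  by rewrite ge0_integralD// lte_add_pinfty.
rewrite (_ : \int[mu]_(x in D) ((g x)%:E - u x) =
  \int[mu]_(x in D) (g x)%:E - \int[mu]_(x in D) u x).
  have := integrable_fin_num mD iu; move: gfin => /=.
  move: (\int[mu]_(x in D) u x) (\int[mu]_(x in D) (g x)%:E) =>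
    [p| |]// [w| |]// _ _.
  by rewrite -!EFinB; congr EFin; lra.
exact: (integralB mD ig iu).
Qed.

Lemma le_majorized_integral (c : R) :
  (c%:E <= \int[mu]_(x in D) (g x)%:E - \int[mu]_(x in D) ((g x)%:E - u x)) =
  (\int[mu]_(x in D) ((g x)%:E - u x) <=
    (\int[mu]_(x in D) (g x)%:E) - c%:E).
Proof.
have := integrable_fin_num mD ig => /=.
have : 0 <= \int[mu]_(x in D) ((g x)%:E - u x).
  by apply: integral_ge0 => x Dx; rewrite subre_ge0 ?ug.
move: (\int[mu]_(x in D) _) (\int[mu]_(x in D) _) => [p| |]// [w| |]// _ _.
by rewrite -!EFinB !lee_fin lerBrDr lerBrDr addrC.
Qed.

End majorized_integral.

Section objective_semicontinuity.
Context (R : realType) (lmax : \bar R) (psi : R -> \bar R) (U : R -> \bar R).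
Hypothesis adm : admissible_psi lmax psi.
Hypothesis Uu : utility U.

Let X := sample_space psi.
Let u (h : R -> \bar R) x := U (fine (h x)).

Lemma utility_measurable (h : R -> \bar R) : e_variable psi h ->
  measurable_fun X (u h).
Proof.
move=> he; have [mh h0 _] := he.
(* Freezing [U] at [U 0] on the negatives gives a function nondecreasing on the whole line, hence
   measurable. *)
pose V y := U (Num.max 0%R y).
have mV : measurable_fun setT V.
  apply: nondecreasing_emeasurable => x y xy; apply: (utility_nd Uu).
    by rewrite le_max lexx.
  by rewrite ge_max le_max lexx/= le_max xy orbT.
apply: (eq_measurable_fun (fun x => V (fine (h x)))).
  move=> x /set_mem Xx; rewrite /V /u max_r//.
  by apply: fine_ge0; exact: h0.
apply: measurableT_comp => //.
by apply: measurableT_comp => //.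
Qed.

Variables a b : R.
Hypothesis b0 : (0 < b)%R.
Hypothesis Uab : forall x : R, (0 <= x)%R -> U x <= (a + b * x)%:E.
Variable Q : probability R R.
Hypothesis Qint : \int[Q]_(x in X) expeR (conjugate psi x) < +oo.

(** One integrable majorant for the utilities of all e-variables. *)
Let g x : R := (a + b * fine (expeR (conjugate psi x)))%R.

Lemma utility_majorant_integrable : Q.-integrable X (EFin \o g).
Proof.
have mX : measurable X := measurable_sample_space adm.
have mexp : measurable_fun X (fun x => expeR (conjugate psi x)).
  apply: measurable_funTS; apply: nondecreasing_emeasurable => x y xy.
  by rewrite lee_expeR; exact: (conjugate_nondecreasing adm).
have iexp : Q.-integrable X (fun x => expeR (conjugate psi x)).
  apply/integrableP; split => //.
  by under eq_integral => x _ do rewrite gee0_abs ?expeR_ge0//.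
apply: (eq_integrable mX (fun x => a%:E + b%:E * expeR (conjugate psi x))).
  move=> x /set_mem Xx /=.
  by rewrite EFinD EFinM fineK//; exact: expeR_conjugate_fin.
apply: integrableD => //; first exact: finite_measure_integrable_cst.
exact: integrableZl.
Qed.

Lemma utility_le_majorant (h : R -> \bar R) x : e_variable psi h -> X x ->
  u h x <= (g x)%:E.
Proof.
move=> he Xx; have [_ h0 _] := he.
have hf := e_variable_fin_num adm he Xx.
apply: le_trans (Uab _) _; first by apply: fine_ge0; exact: h0.
rewrite lee_fin lerD2l ler_wpM2l ?(ltW b0)//.
apply: fine_le => //; first exact: expeR_conjugate_fin.
exact: (e_variable_le_conjugate adm).
Qed.

Lemma le_utility_integral (h : R -> \bar R) (c : R) : e_variable psi h ->
  (c%:E <= utility_integral psi U h Q) =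
  (\int[Q]_(x in X) ((g x)%:E - u h x) <= \int[Q]_(x in X) (g x)%:E - c%:E).
Proof.
move=> he; have mX : measurable X := measurable_sample_space adm.
have hX : sample_space psi `&` dom h = X.
  apply/seteqP; split => [x []//|x Xx]; split => //.
  by have := e_variable_fin_num adm he Xx; rewrite /dom/= fin_numElt => /andP[].
have ug x : X x -> u h x <= (g x)%:E by exact: utility_le_majorant.
rewrite -(le_majorized_integral mX utility_majorant_integrable ug).
rewrite -(majorized_integralE mX (utility_measurable he)
  utility_majorant_integrable ug).
by rewrite /utility_integral hX.
Qed.

(** Fatou's lemma for [g - u (H_ k)]: upper semicontinuity of [U] bounds the integrand for [H] by
    the lower limit, and monotonicity of [U] compares [H_ k] with [h_ k]. *)
Lemma utility_integral_limit (h_ H_ : nat -> R -> \bar R) (H : R -> \bar R)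
    (c : R) :
  (forall k, e_variable psi (h_ k)) -> (forall k, e_variable psi (H_ k)) ->
  e_variable psi H ->
  (forall k x, X x -> h_ k x <= H_ k x) ->
  (forall x, X x -> H_ k x @[k --> \oo] --> H x) ->
  (\forall k \near \oo, c%:E <= utility_integral psi U (h_ k) Q) ->
  c%:E <= utility_integral psi U H Q.
Proof.
move=> he_ He_ He hH Hcv hc.
have mX : measurable X := measurable_sample_space adm.
have mg : measurable_fun X (EFin \o g) :=
  measurable_int Q utility_majorant_integrable.
have mgu h : e_variable psi h -> measurable_fun X (fun x => (g x)%:E - u h x).
  by move=> he; apply: emeasurable_funB => //; exact: utility_measurable.
have gu0 h x : e_variable psi h -> X x -> 0 <= (g x)%:E - u h x.
  by move=> he Xx; rewrite subre_ge0 ?utility_le_majorant.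
rewrite le_utility_integral//.
apply: (@le_trans _ _
    (\int[Q]_(x in X) limn_einf (fun k => (g x)%:E - u (H_ k) x))).
  apply: ge0_le_integral => //.
  - by move=> x Xx; exact: gu0.
  - exact: mgu.
  - apply: (emeasurable_fun_cvg (fun n x => einfs (fun k =>
    (g x)%:E - u (H_ k) x) n)).
      by move=> n; apply: measurable_fun_einfs => k; exact: mgu.
    by move=> x Xx; rewrite limn_einf_lim; exact: is_cvg_einfs.
  - move=> x Xx; have [_ H0 _] := He.
    have fH := e_variable_fin_num adm He Xx.
    have le_above r : u H x < r%:E ->
        (g x)%:E - r%:E <= limn_einf (fun k => (g x)%:E - u (H_ k) x).
      move=> ur; apply: limn_einf_ge_near.
      have fine_cv : fine (H_ k x) @[k --> \oo] --> fine (H x).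
        by apply: fine_cvg; rewrite fineK//; exact: Hcv.
      have Hx0 : (0 <= fine (H x))%R by rewrite fine_ge0// H0.
      have near_u : nbhs (fine (H x)) [set y : R | (0 <= y)%R -> U y < r%:E].
        exact: (utility_usc Uu Hx0 ur).
      have h2 : \forall k \near \oo, (0 <= fine (H_ k x))%R ->
          U (fine (H_ k x)) < r%:E by exact: (fine_cv _ near_u).
      near=> k.
      have Uk : (0 <= fine (H_ k x))%R -> U (fine (H_ k x)) < r%:E by near: k.
      have [_ Hk0 _] := He_ k.
      by rewrite leeB// ltW// Uk// fine_ge0// Hk0.
    have uHg := utility_le_majorant He Xx.
    (* For a finite value the level [r + e] decreases to it; for the value -oo every real level is
       available and the lower limit is +oo. *)
    case E : (u H x) uHg => [r| |]// _.
      apply/lee_addgt0Pr => e e0.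
      have := le_above (r + e)%R; rewrite E lte_fin ltrDl => /(_ e0).
      rewrite -leeBlDr//; apply: le_trans.
      by rewrite -!EFinB lee_fin; lra.
    rewrite leye_eq; apply/eqP/eqyP => r _.
    have := le_above (g x - r)%R; rewrite E ltNyr => /(_ isT).
    by rewrite -EFinB subKr.
apply: le_trans (fatou Q mX (fun k => mgu _ (He_ k)) (fun k x Xx =>
  gu0 _ _ (He_ k) Xx)) _.
apply: limn_einf_le_near; apply: filterS hc => k hk.
move: hk; rewrite (le_utility_integral _ (he_ k)); apply: le_trans.
apply: ge0_le_integral => //.
- by move=> x Xx; exact: gu0.
- exact: mgu.
- exact: mgu.
- move=> x Xx; rewrite leeB//; apply: (utility_nd Uu).
    by have [_ h0 _] := he_ k; rewrite fine_ge0// h0.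
  by apply: fine_le; rewrite ?(e_variable_fin_num adm)//; exact: hH.
Unshelve. all: end_near. Qed.

End objective_semicontinuity.

(** * Mixing measures and the optimal mixture *)

(** The mixing measure is the image of the uniform law under [q], by change of variables. *)
Lemma mixture_quantile (R : realType) (lmax : \bar R) (psi : R -> \bar R)
    (q : R -> \bar R) : admissible_psi lmax psi -> quantile lmax q ->
  exists pi : probability (\bar R) R, pi (~` Lam lmax) = 0 /\
    mixture lmax psi pi = quantile_mixture psi q.
Proof.
move=> adm [qm qL].
have mq : measurable_fun (setT : set (measurableTypeR R)) q.
  exact: nondecreasing_emeasurable.
pose qmix := isMeasurableFun.Build _ _ _ _ _ mq.
pose qf : {mfun measurableTypeR R >-> \bar R} := HB.pack q qmix.
have qLT : q @^-1` Lam lmax = setT.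
  by apply/seteqP; split => // t _; exact: qL.
exists (distribution (uniform_prob (@ltr01 R)) qf); split.
  rewrite /distribution /pushforward /= (_ : _ @^-1` _ = set0) ?measure0//.
  by apply/seteqP; split => // t /=; apply; exact: qL.
apply/funext => x; rewrite /mixture /distribution.
rewrite ge0_integral_pushforward//=.
- by rewrite qLT.
- exact: measurable_Lam.
- exact: (ext_exp_term_measurable adm).
- by move=> l /set_mem; exact: (ext_exp_term_ge0 adm).
Qed.

Theorem theorem7p4 (R : realType) (lmax : \bar R) (psi : R -> \bar R)
    (Qs : set (probability R R)) (U : R -> \bar R)
    (chi : probability R R -> R) :
  admissible_psi lmax psi ->
  alternative_hypothesis psi Qs ->
  utility U ->
  (forall Q, Qs Q ->
    \int[Q]_(x in sample_space psi) expeR (conjugate psi x) < +oo) ->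
  exists pi : probability (\bar R) R,
    [/\ pi (~` Lam lmax) = 0,
        e_variable psi (mixture lmax psi pi) &
        objective psi Qs U chi (mixture lmax psi pi) =
          ereal_sup [set objective psi Qs U chi h | h in e_variable psi]].
Proof.
move=> adm _ Uu Qint.
set S := ereal_sup _.
(* The point mass at [l = 0] gives the constant e-variable 1, so the supremum is over a nonempty
   set. *)
have [q1 hq1 q1E] : exists2 q, quantile lmax q &
    e_variable psi (quantile_mixture psi q).
  have p0 : dom psi 0%R by rewrite /dom/= (psi_at0 adm).
  have sdom l : l \in [:: 0%R : R] -> dom psi l by rewrite inE => /eqP ->.
  have [q hq qE] := quantile_average adm (isT : (0 < size [:: 0%R : R])%N) sdom.
  by exists q => //; rewrite (funext qE); exact: (e_variable_average adm).
have [|v vP vS] := @ereal_sup_seq R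
    [set objective psi Qs U chi h | h in e_variable psi].
  by exists (objective psi Qs U chi (quantile_mixture psi q1)),
    (quantile_mixture psi q1).
have {}vP n : exists h, e_variable psi h /\ objective psi Qs U chi h = v n.
  by have [h] := vP n; exists h.
have [h_ h_P] := choice vP.
have he_ n : e_variable psi (h_ n) by have [] := h_P n.
have [q_ q_P] := choice (fun n => e_variable_dominated adm (he_ n)).
have hq_ n : quantile lmax (q_ n) by have [] := q_P n.
have hqe_ n : e_variable psi (quantile_mixture psi (q_ n)) by have [] := q_P n.
have [phi [q [phik hq hqe cv]]] := quantile_mixture_compact adm hq_ hqe_.
have [pi [piL piE]] := mixture_quantile adm hq.
exists pi; rewrite piE; split => //.
apply/eqP; rewrite eq_le; apply/andP; split.
  by apply: ereal_sup_ubound; exists (quantile_mixture psi q).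
(* Any rational level [r] below the supremum is eventually exceeded along the maximising sequence;
   for each [Q] the level [r + chi Q] then passes to the limit mixture. *)
rewrite leNgt; apply/negP => /ereal_lt_rat[r /andP[qr rS]].
move: qr; apply/negP; rewrite -leNgt.
apply: le_ereal_inf_tmp => _ [Q QQ <-].
rewrite leeBrDr// -EFinD.
have [a [b [b0 Uab]]] := utility_affine Uu.
apply: (utility_integral_limit adm Uu b0 Uab (Qint _ QQ)
  (fun k => he_ (phi k)) (fun k => hqe_ (phi k)) hqe _ cv).
  by move=> k x Xx; have [_ _] := q_P (phi k); apply.
have [N _ NS] := vS _ rS.
exists N => // k /= Nk.
rewrite EFinD -leeBrDr//; apply: ltW;
  apply: lt_le_trans (NS _ (leq_trans Nk (phik k))) _.
have [_ <-] := h_P (phi k).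
by apply: ereal_inf_lbound; exists Q.
Qed.
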